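(* Let $0<\epsilon<0.5$. For all sufficiently large $n$ and every positive integer $k \leq \log_4\log_4(n^{0.5-\epsilon})$, \[\frac{\binom{n}{k}}{\binom{2k}{k}} \leq \gamma(n,k,2k) \leq \frac{\binom{n}{k}}{\binom{2k}{k}}(1+o(1)),\] where $o(1)$ denotes a quantity tending to $0$ as $n\to\infty$.
   Context: $[n]=\{1,\ldots,n\}$. A bicoloring of $[n]$ is a map $B:[n]\to\{-1,+1\}$; it is a $k$-bicoloring if it takes the value $+1$ on exactly $k$ points. Put $Y_B=(B(1),\ldots,B(n))$, and for $A\subseteq[n]$ let $X_A\in\{0,1\}^n$ be its incidence vector. A non-empty set $A\subseteq[n]$ is an unbiased representative for $B$ if $\langle X_A,Y_B\rangle=0$. A family $\mathcal{A}$ of subsets of $[n]$ is a system of unbiased representatives (SUR) for a set $\mathcal{B}$ of bicolorings if every $B\in\mathcal{B}$ has an unbiased representative in $\mathcal{A}$. $\gamma(n,k,r)$ is the maximum, over all sets $\mathcal{B}$ of $k$-bicolorings of $[n]$, of the minimum cardinality of a SUR for $\mathcal{B}$ all of whose members have cardinality exactly $r$; equivalently, it is this minimum cardinality when $\mathcal{B}$ is the set of all $\binom{n}{k}$ $k$-bicolorings. *)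

(* Defs.v *)
From HB Require Import structures.
From mathcomp Require Import all_boot all_order all_algebra.
Set Implicit Arguments.
Unset Strict Implicit.
Unset Printing Implicit Defensive.
Import Order.TTheory GRing.Theory Num.Theory.
Local Open Scope ring_scope.

(* Written with MathComp and, for logarithms, MathComp-Analysis.  The ground
   set [n] is 'I_n. *)

(* [true] stands for the colour +1 and [false] for -1, see [color_vec]. *)
Definition bicoloring (n : nat) : finType := {ffun 'I_n -> bool}.

Definition color_vec n (B : bicoloring n) : 'rV[int]_n :=
  \row_i (if B i then 1 else -1).

Definition incidence_vec n (A : {set 'I_n}) : 'rV[int]_n :=
  \row_i (i \in A)%:R.

Definition dotp n (u v : 'rV[int]_n) : int := \sum_i u 0 i * v 0 i.

Definition k_bicoloring (k n : nat) (B : bicoloring n) : bool :=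
  #|[set i | color_vec B 0 i == 1]| == k.

Definition k_bicolorings (n k : nat) : {set bicoloring n} :=
  [set B | k_bicoloring k B].

Definition unbiased_rep n (A : {set 'I_n}) (B : bicoloring n) : bool :=
  (A != set0) && (dotp (incidence_vec A) (color_vec B) == 0).

Definition SUR n (F : {set {set 'I_n}}) (BB : {set bicoloring n}) : bool :=
  [forall B in BB, [exists A in F, unbiased_rep A B]].

Definition r_subsets (n r : nat) : {set {set 'I_n}} := [set A : {set 'I_n} | #|A| == r].

Definition uniform_SUR n r (BB : {set bicoloring n}) (F : {set {set 'I_n}})
    : bool :=
  (F \subset r_subsets n r) && SUR F BB.

(* The starting point of the [arg min] is the largest r-uniform family: by
   [uniform_SUR_r_subsets] it is a SUR for BB as soon as BB has an r-uniform
   SUR, and then the value is the true minimum.  Otherwise no r-uniform SUR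
   exists and the value, 'C(n, r), is meaningless; for r = 2k and k-bicolorings
   with 0 < k and 2k <= n this does not occur. *)
Definition min_SUR n r (BB : {set bicoloring n}) : nat :=
  #|[arg min_(F < r_subsets n r | uniform_SUR r BB F) #|F|]|.

Lemma uniform_SUR_r_subsets n r (BB : {set bicoloring n}) F :
  uniform_SUR r BB F -> uniform_SUR r BB (r_subsets n r).
Proof.
move=> /andP[/subsetP FS /forall_inP FB]; apply/andP; split => //.
apply/forall_inP => B /FB /exists_inP[A AF AB].
by apply/exists_inP; exists A => //; exact: FS.
Qed.

Definition gamma (n k r : nat) : nat :=
  (\max_(BB : {set bicoloring n} | BB \subset k_bicolorings n k)
     min_SUR r BB)%N.

From mathcomp Require Import all_classical all_reals all_analysis.

(* [ln] is 0 on nonpositive reals. *)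
Definition log4 {R : realType} (x : R) : R := ln x / ln 4.

(* Main.v *)
Require Import Defs.
From mathcomp Require Import all_boot all_order all_algebra.
From mathcomp Require Import all_classical all_reals all_analysis.
From mathcomp Require Import zify ring lra.
Set Implicit Arguments.
Unset Strict Implicit.
Unset Printing Implicit Defensive.
Import Order.TTheory GRing.Theory Num.Theory.
Import numFieldNormedType.Exports.

(** A 2k-set A is unbiased for a k-bicoloring exactly when it contains the k
points coloured +1, so gamma(n, k, 2k) is the covering number of the k-subsets
of [n] by 2k-subsets.  Write v = C(n, k) and r = C(2k, k); counting incidences
gives the lower bound v / r.

For the upper bound, pick pairwise non-overlapping blocks greedily, each among
the blocks all of whose k-subsets are still uncovered.  For a uniformly random
such block the degree of an uncovered k-set follows in expectation the
trajectory D (m / v)^(r - 1), m being the number of uncovered k-sets, and it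
changes by little in one step because the codegrees are smaller than D by a
factor of order n.  Hence an exponential potential of the deviations has a
choice of block that does not increase it, and the degrees stay close to the
trajectory as long as n is large compared with (v / m)^(O(r)).

This cannot reach an uncovered fraction below 1 / r when n is only
4^(4^(k + 1/2)).  So 2k-sets are used down to an uncovered fraction
u0 = delta / k^2, delta a small constant, while the degrees with respect to b-sets, b = 2k - log_2 k, are tracked
too.  Then b-sets, which contain only about r / k (at least r / k^2) k-subsets
each, are used to shrink the remainder by a further factor 1 / r, at the
negligible cost of at most (v / r) u0 k^2 blocks; what is left is covered
one k-set at a time. *)

(** * Double counting of degrees in a hypergraph of blocks *)

Lemma card_sep_sum (I : finType) (P : {set I}) (p : pred I) :
  #|[set i in P | p i]| = \sum_(i in P) (p i : nat).
Proof.
rewrite -sum1_card big_mkcond [RHS]big_mkcond /=; apply: eq_bigr => i _.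
by rewrite inE; case: (i \in P); case: (p i).
Qed.

Section Blocks.
Variables (V B : finType) (inc : B -> {set V}).
Implicit Types (F : {set B}) (U : {set V}) (T : V) (b A : B).

(** [U] is the set of points still uncovered; full blocks are those that can be taken without
    overlapping earlier ones. *)
Definition full F U : {set B} := [set b in F | inc b \subset U].
Definition deg F U T : nat := #|[set b in full F U | T \in inc b]|.
Definition codeg F T T' : nat :=
  #|[set b in F | (T \in inc b) && (T' \in inc b)]|.
(** The blocks through [T] that stop being full once [A] is taken; by [deg_setD] this is the exact
    loss of degree. *)
Definition hit F U T A : nat :=
  #|[set b in full F U | (T \in inc b) && ~~ [disjoint inc b & inc A]]|.

Lemma sum_card_inc (P : {set B}) (S : {set V}) :
  \sum_(b in P) #|S :&: inc b| = \sum_(T in S) #|[set b in P | T \in inc b]|.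
Proof.
transitivity (\sum_(b in P) \sum_(T in S) (T \in inc b : nat)).
  apply: eq_bigr => b _; rewrite -sum1_card big_mkcond [RHS]big_mkcond /=.
  by apply: eq_bigr => T _; rewrite inE; case: (T \in S); case: (T \in inc b).
rewrite exchange_big /=; apply: eq_bigr => T _.
rewrite -sum1_card big_mkcond [RHS]big_mkcond /=.
by apply: eq_bigr => b _; rewrite inE; case: (b \in P); case: (T \in inc b).
Qed.

Lemma sum_deg F U q : (forall b, b \in F -> #|inc b| = q) ->
  \sum_(T in U) deg F U T = #|full F U| * q.
Proof.
move=> Fq; rewrite -sum_card_inc -sum_nat_const; apply: eq_bigr => b.
by rewrite inE => /andP[/Fq <- /finset.setIidPr ->].
Qed.

Lemma deg_setD F U T A : deg F (U :\: inc A) T + hit F U T A = deg F U T.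
Proof.
rewrite /deg /hit -cardsUI.
set I := _ :&: _; have -> : I = finset.set0.
  apply/finset.setP => b; rewrite !inE finset.subsetD.
  by case: [disjoint _ & _]; rewrite ?andbF.
rewrite cards0 addn0; apply: eq_card => b; rewrite !inE finset.subsetD.
by case: (b \in F); case: (inc b \subset U); case: (T \in inc b) => //=;
  case: [disjoint _ & _].
Qed.

(** A lost block contains [T] and a point [T'] of [A], with [T' != T] because [A] avoids [T]; the
    union bound over [T'] costs one codegree each. *)
Lemma hit_le F U T A c : T \notin inc A ->
  (forall T', T' != T -> codeg F T T' <= c) -> hit F U T A <= #|inc A| * c.
Proof.
move=> TA Fc.
apply: (@leq_trans (\sum_(T' in inc A) codeg F T T')); last first.
  rewrite -sum_nat_const; apply: leq_sum => T' T'A; apply: Fc.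
  by apply: contraNneq TA => <-.
have -> : \sum_(T' in inc A) codeg F T T'
    = \sum_(b in [set b in F | T \in inc b]) #|inc A :&: inc b|.
  rewrite sum_card_inc; apply: eq_bigr => T' _; apply: eq_card => b.
  by rewrite !inE andbA.
rewrite /hit -sum1_card big_mkcond [X in _ <= X]big_mkcond /=.
apply: leq_sum => b _; rewrite !inE.
case: (b \in F); case: (T \in inc b) => //=; case: (inc b \subset U) => //=.
by rewrite -finset.setI_eq0 finset.setIC -card_gt0; case: ifP.
Qed.

(** Regrouping the pairs [(A, b)] by the lost block [b] makes the average loss computable from
    degrees. *)
Lemma sum_hit F F0 U T :
  \sum_(A in full F0 U | T \notin inc A) hit F U T A =
  \sum_(b in full F U | T \in inc b)
     #|[set A in full F0 U | (T \notin inc A) && ~~ [disjoint inc b & inc A]]|.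
Proof.
transitivity (\sum_(A in full F0 U) \sum_(b in full F U)
   ([&& T \in inc b, T \notin inc A & ~~ [disjoint inc b & inc A]] : nat)).
  rewrite big_mkcondr; apply: eq_bigr => A _; rewrite /hit card_sep_sum.
  case: (T \notin inc A); first by [].
  by rewrite big1 // => b _; rewrite andbF.
rewrite exchange_big big_mkcondr; apply: eq_bigr => b _ /=.
case: (T \in inc b); last by rewrite big1.
by rewrite card_sep_sum.
Qed.

(** Union bound over the common points of [A] and [b], which differ from [T] because [A] avoids
    [T]. *)
Lemma card_meeting_le F0 U T b : T \in inc b ->
  #|[set A in full F0 U | (T \notin inc A) && ~~ [disjoint inc b & inc A]]|
    <= \sum_(T' in inc b :\ T) deg F0 U T'.
Proof.
move=> Tb; rewrite -sum_card_inc -sum1_card big_mkcond [X in _ <= X]big_mkcond /=.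
apply: leq_sum => A _; rewrite inE; case: (A \in _) => //=.
case: ifP => // /andP[TA]; rewrite -finset.setI_eq0 -card_gt0 => /leq_trans; apply.
apply: subset_leq_card; apply/fintype.subsetP => x; rewrite !inE => /andP[-> xA].
by rewrite xA !andbT; apply: contraNneq TA => <-.
Qed.

(* Second Bonferroni inequality, in the form t <= [t > 0] + t (t - 1). *)
Lemma card_meeting_ge F0 U T b c : T \in inc b ->
  (forall T1 T2, T1 != T2 -> codeg F0 T1 T2 <= c) ->
  \sum_(T' in inc b :\ T) deg F0 U T' <=
  #|[set A in full F0 U | (T \notin inc A) && ~~ [disjoint inc b & inc A]]|
    + #|inc b| ^ 2 * c.
Proof.
move=> Tb Fc; set S := inc b :\ T; set M := [set A in _ | _].
(* Used with [T1 = T] for the blocks through [T], which lie outside [M], and with [T1] in [S] for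
   the term t (t - 1). *)
have pair T1 (S' : {set V}) : T1 \notin S' ->
    \sum_(A in full F0 U | T1 \in inc A) #|S' :&: inc A| <= #|S'| * c.
  move=> T1S; rewrite -sum_nat_const.
  apply: (@leq_trans (\sum_(T2 in S') codeg F0 T1 T2)); last first.
    by apply: leq_sum => T2 T2S; apply: Fc; apply: contraNneq T1S => ->.
  have -> : \sum_(T2 in S') codeg F0 T1 T2
      = \sum_(A in [set A in F0 | T1 \in inc A]) #|S' :&: inc A|.
    rewrite sum_card_inc; apply: eq_bigr => T2 _; apply: eq_card => A.
    by rewrite !inE andbA.
  rewrite big_mkcond [X in _ <= X]big_mkcond /=; apply: leq_sum => A _.
  by rewrite !inE; case: (A \in F0); case: (inc A \subset U); case: (T1 \in inc A).
have cS : #|inc b| = #|S|.+1 by rewrite (cardsD1 T) Tb.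
have TS : T \notin S by rewrite !inE eqxx.
rewrite -sum_card_inc.
have step A : A \in full F0 U -> #|S :&: inc A| <= (A \in M)
    + (if T \in inc A then #|S :&: inc A| else 0)
    + \sum_(T1 in S) (if T1 \in inc A then #|(S :\ T1) :&: inc A| else 0).
  move=> AF; case: ifP => TA; first by rewrite -addnA addnCA leq_addr.
  rewrite addn0 inE AF TA /=.
  have [->|ne] := eqVneq (S :&: inc A) finset.set0; first by rewrite cards0.
  have -> : ~~ [disjoint inc b & inc A].
    rewrite -finset.setI_eq0; apply: contraNneq ne => e0; apply/eqP/finset.setP => x.
    by move/finset.setP/(_ x): e0; rewrite !inE; case: (x == T).
  rewrite -big_mkcondr /=.
  have /finset.set0Pn[T1 T1in] := ne.
  have -> : \sum_(T2 in S | T2 \in inc A) #|(S :\ T2) :&: inc A|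
      = #|S :&: inc A| * #|S :&: inc A|.-1.
    rewrite -sum_nat_const; apply: eq_big => [T2|T2 T2in]; first by rewrite finset.in_setI.
    rewrite (cardsD1 T2 (S :&: inc A)) finset.in_setI T2in /=.
    by apply: eq_card => x; rewrite !inE; case: (x == T2).
  have : 0 < #|S :&: inc A| by rewrite card_gt0.
  nia.
apply: leq_trans (leq_sum _ step) _; rewrite !big_split /=.
have -> : \sum_(A in full F0 U) (A \in M : nat) = #|M|.
  by rewrite card_sep_sum; apply: eq_bigr => A AF; rewrite inE AF.
rewrite -addnA leq_add2l -big_mkcondr /=.
rewrite exchange_big /=.
apply: (@leq_trans (#|S| * c + \sum_(T1 in S) #|S| * c)).
  apply: leq_add; first exact: pair.
  apply: leq_sum => T1 T1S; rewrite -big_mkcondr /=.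
  apply: leq_trans (pair _ _ _) _; first by rewrite !inE eqxx.
  by rewrite leq_mul2r subset_leq_card ?orbT // finset.subsetDl.
rewrite sum_nat_const cS; nia.
Qed.

End Blocks.

(** * The hypergraph whose points are k-sets and whose blocks are larger sets *)

Section Subsets.
Variables (X : finType) (k : nat).
Implicit Types (A S T : {set X}).

Definition ksubsets A : {set {set X}} := [set T : {set X} | T \subset A & #|T| == k].

Definition uniform_sets b : {set {set X}} := [set A : {set X} | #|A| == b].

Lemma card_supersets S b : #|S| <= b ->
  #|[set A in uniform_sets b | S \subset A]| = 'C(#|X| - #|S|, b - #|S|).
Proof.
move=> leSb; have -> : #|X| - #|S| = #|~: S| by rewrite -(cardsC S) addKn.
rewrite -cards_draws.
rewrite [RHS](_ : _ = #|(fun A => A :|: S) @: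
    [set A : {set X} | (A \subset ~: S) && (#|A| == b - #|S|)]|); last first.
  rewrite card_in_imset // => A1 A2; rewrite !inE.
  move=> /andP[/fintype.subsetP s1 _] /andP[/fintype.subsetP s2 _] /finset.setP e.
  apply/finset.setP => x; move: (e x) (s1 x) (s2 x); rewrite !inE.
  case: (x \in S) => /=; last by rewrite !orbF.
  by case: (x \in A1); case: (x \in A2) => //= _ h1 h2;
    first [by have := h1 isT | by have := h2 isT].
apply: eq_card => A; rewrite !inE.
apply/andP/imsetP => [[/eqP cA SA]|[A' + ->]].
  exists (A :\: S); last first.
    rewrite finset.setDE finset.setUIl [~: S :|: S]finset.setUC finset.setUCr.
    by rewrite finset.setIT (finset.setUidPl SA).
  by rewrite inE finset.setDE finset.subsetIr -finset.setDE cardsDS // cA eqxx.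
rewrite inE => /andP[sA' /eqP cA']; rewrite finset.subsetUr; split=> //.
move: sA'; rewrite -finset.disjoints_subset => dA'.
have /eqP -> : #|A' :|: S| == #|A'| + #|S| by rewrite (leq_card_setU A' S).2.
by rewrite cA' subnK.
Qed.

Lemma full_uniform_sets b :
  full ksubsets (uniform_sets b) (ksubsets finset.setT) = uniform_sets b.
Proof.
apply/finset.setP => A; rewrite finset.in_set; apply: andb_idr => _.
by apply/fintype.subsetP => T; rewrite !inE finset.subsetT => /andP[].
Qed.

Lemma deg_uniform_sets b T : #|T| = k -> k <= b ->
  deg ksubsets (uniform_sets b) (ksubsets finset.setT) T = 'C(#|X| - k, b - k).
Proof.
move=> cT kb; rewrite /deg full_uniform_sets -[in RHS]cT -card_supersets ?cT //.
by apply: eq_card => A; rewrite !inE cT eqxx andbT.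
Qed.

(** Two distinct k-sets span at least k + 1 elements, so their common blocks contain a fixed (k +
    1)-set. If one of them is not a k-set, the codegree is 0. *)
Lemma codeg_uniform_sets b T T' : T != T' -> k < b ->
  codeg ksubsets (uniform_sets b) T T' <= 'C(#|X| - k.+1, b - k.+1).
Proof.
move=> neT kb.
have [/eqP cT|cT] := boolP (#|T| == k); last first.
  rewrite /codeg (_ : [set b in _ | _] = finset.set0) ?cards0 //; apply/finset.setP => A.
  by rewrite !inE (negPf cT) andbF /= andbF.
have [/eqP cT'|cT'] := boolP (#|T'| == k); last first.
  rewrite /codeg (_ : [set b in _ | _] = finset.set0) ?cards0 //; apply/finset.setP => A.
  by rewrite !inE (negPf cT') !andbF.
have /fintype.subsetPn[x xT' xT] : ~~ (T' \subset T).
  by apply: contra neT => sT; rewrite eq_sym eqEcard sT cT cT' leqnn.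
have cS : #|x |: T| = k.+1 by rewrite cardsU1 xT cT.
rewrite -cS -card_supersets ?cS //.
apply: subset_leq_card; apply/fintype.subsetP => A; rewrite !inE.
move=> /and3P[-> /andP[sT _] /andP[/fintype.subsetP sT' _]].
by rewrite finset.subUset finset.sub1set sT' // sT.
Qed.

Lemma card_ksubsets A : #|ksubsets A| = 'C(#|A|, k).
Proof. by rewrite -cards_draws. Qed.

End Subsets.

(** * Growth of central binomial coefficients *)

Lemma central_bin_sqr_le k : 'C(2 * k, k) ^ 2 * (2 * k + 1) <= 16 ^ k.
Proof.
elim: k => [|k IH]; first by rewrite bin0.
have e1 := mul_bin_diag (2 * k + 2) k.
have e2 := mul_bin_diag (2 * k + 1) k.
have e3 : 'C(2 * k + 1, k) = 'C(2 * k + 1, k.+1).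
  by rewrite -[RHS]bin_sub; [congr 'C(_, _)|]; lia.
rewrite (_ : (2 * k + 2).-1 = 2 * k + 1) in e1; last by lia.
rewrite (_ : (2 * k + 1).-1 = 2 * k) in e2; last by lia.
rewrite (_ : 2 * k.+1 = 2 * k + 2); last by lia.
have e : k.+1 * 'C(2 * k + 2, k.+1) = 2 * ((2 * k + 1) * 'C(2 * k, k)).
  by rewrite -e1 e2 -e3; lia.
rewrite -(@leq_pmul2l (k.+1 ^ 2)) // mulnA -expnMn e (expnS 16).
move: IH; set c := 'C(2 * k, k); set p := 16 ^ k => IH.
have h : (c ^ 2 * (2 * k + 1)) * (4 * ((2 * k + 1) * (2 * k + 3))) <=
     p * (4 * ((2 * k + 1) * (2 * k + 3))) by rewrite leq_mul2r IH orbT.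
have h' : p * (4 * ((2 * k + 1) * (2 * k + 3))) <= p * (16 * k.+1 ^ 2).
  by rewrite leq_mul2l; apply/orP; right; lia.
apply: leq_trans (leq_trans _ (leq_trans h h')) _; last by lia.
by rewrite -!mulnn; lia.
Qed.

(** For m = 2k - i with i < t, the ratio C(m, k) / C(m - 1, k) = m / (m - k) lies between 2 and
    3. *)
Lemma bin_shift_bounds k t : 2 * t <= k + 2 -> t <= k ->
  2 ^ t * 'C(2 * k - t, k) <= 'C(2 * k, k) <= 3 ^ t * 'C(2 * k - t, k).
Proof.
elim: t => [|t IH] t2 tk; first by rewrite !mul1n subn0 leqnn.
have /andP[h1 h2] := IH ltac:(lia) ltac:(lia).
have := mul_bin_down (2 * k - t) k; rewrite -subnS.
move: h1 h2; rewrite !expnS; set x := 'C(_ - t.+1, _); set y := 'C(_ - t, _).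
set z := 'C(_, _) => h1 h2 e.
have m0 : 0 < 2 * k - t by lia.
have y1 : 2 * x <= y by rewrite -(leq_pmul2l m0); nia.
have y2 : y <= 3 * x by rewrite -(leq_pmul2l m0); nia.
apply/andP; split; first by apply: leq_trans h1; nia.
by apply: leq_trans h2 _; nia.
Qed.

Lemma sqr_le_exp2 j : 26 <= j -> (2 ^ 8 * j) ^ 2 <= 2 ^ j.
Proof.
move=> j26; rewrite -(subnKC j26); move: (j - 26) => i.
have : (i + 26) ^ 2 <= 2 ^ (i + 10).
  elim: i => [|i IH]; first by [].
  rewrite [i.+1 + 10]addSn (expnS 2); move: IH; set p := 2 ^ (i + 10); clearbody p.
  by rewrite -!mulnn; nia.
have -> : 2 ^ (26 + i) = (2 ^ 8) ^ 2 * 2 ^ (i + 10) by rewrite -expnM -expnD; congr (2 ^ _); lia.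
by rewrite expnMn [i + 26]addnC leq_mul2l => ->; rewrite orbT.
Qed.

(** By [central_bin_sqr_le], C(2k, k) is smaller than 4^k by a factor sqrt(2k + 1), which for large
    k absorbs both 66 and the logarithm of the base. *)
Lemma exp_central_bin_le P : exists k0, forall k, k0 <= k ->
  (32 * P * k ^ 2) ^ (66 * 'C(2 * k, k)) <= 2 ^ (4 ^ k.+1).
Proof.
exists (2 ^ (P + 26)) => k kk0.
have k_gt0 : 0 < k by apply: leq_trans kk0; rewrite expn_gt0.
pose j := trunc_log 2 k.
have jP : P + 26 <= j by rewrite trunc_log_max.
have jk : 2 ^ j <= k by rewrite trunc_logP.
have kj : k <= 2 ^ j.+1 by apply: ltnW; rewrite trunc_log_ltn.
have wl : 32 * P * k ^ 2 <= 2 ^ (3 * j).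
  apply: (@leq_trans (2 ^ 5 * 2 ^ P * (2 ^ j.+1) ^ 2)).
    by rewrite !leq_mul // ?leq_exp2r // ltnW // ltn_expl.
  by rewrite -expnM -!expnD leq_exp2l //; lia.
apply: (@leq_trans ((2 ^ (3 * j)) ^ (66 * 'C(2 * k, k)))).
  by rewrite leq_exp2r // muln_gt0 bin_gt0; lia.
rewrite -expnM leq_exp2l //.
apply: (@leq_trans (4 ^ k)); last by rewrite leq_exp2l.
rewrite -(@leq_exp2r _ _ 2) // -expnM [k * 2]mulnC expnM (_ : 4 ^ 2 = 16) //.
apply: leq_trans (central_bin_sqr_le k).
have := sqr_le_exp2 (leq_trans (leq_addl _ _) jP).
move: jk; set c := 'C(_, _); set p := 2 ^ j => jk h.
have h' : (198 * j) ^ 2 <= 2 * k + 1.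
  apply: leq_trans (leq_trans h _); last by lia.
  by rewrite leq_exp2r // leq_mul2r; apply/orP; right.
have -> : (3 * j * (66 * c)) ^ 2 = c ^ 2 * (198 * j) ^ 2 by rewrite -!mulnn; lia.
by rewrite leq_mul2l h' orbT.
Qed.

(** The threshold must not depend on [k]: the finitely many small [k] are absorbed into [N]. *)
Lemma exp_central_bin_eventually P : exists N, forall n k, N <= n -> 0 < k ->
  2 ^ (4 ^ k.+1) <= n -> (32 * P * k ^ 2) ^ (66 * 'C(2 * k, k)) <= n.
Proof.
have [k0 large] := exp_central_bin_le P.
exists (\max_(i < k0) (32 * P * i ^ 2) ^ (66 * 'C(2 * i, i))) => n k Nn k_gt0 kn.
have [k0k|kk0] := leqP k0 k; first exact: leq_trans (large k k0k) kn.
apply: leq_trans Nn.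
exact: (leq_bigmax_cond (F := fun i : 'I_k0 => (32 * P * i ^ 2) ^ (66 * 'C(2 * i, i))) (Ordinal kk0)).
Qed.

Lemma leq_expn2r m n e : m <= n -> m ^ e <= n ^ e.
Proof. by case: e => // e; rewrite leq_exp2r. Qed.

(** * Numerical estimates *)

Section BlockSize.
Variables (P k n : nat).
Hypotheses (P0 : (0 < P)%N) (k0 : (0 < k)%N).
Let r := 'C(2 * k, k).
Let t := trunc_log 2 k.
Let b := (2 * k - t)%N.
Let r' := 'C(b, k).
Let w := ((32 * P * k ^ 2) ^ r)%N.

(** Since 2^t is within a factor 2 of k, [bin_shift_bounds] places [r'] between r / k^2 and 2r / k.
    The upper bound is the reason for using b-sets: r^r' <= 4^(k r') <= 16^r, so shrinking by a
    factor 1 / r costs only a constant to the power r. *)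
Lemma block_size_bounds : [/\ (k < b <= 2 * k)%N, (r <= k ^ 2 * r')%N,
   (r ^ r' * (2 * P * k ^ 2) ^ r <= w)%N &
   (400 * (400 * (8 * (P * k ^ 4 * r ^ 2))) <= w ^ 9)%N].
Proof.
have tk : (2 ^ t <= k)%N by rewrite trunc_logP.
have kt : (k <= 2 * 2 ^ t)%N by rewrite -expnS ltnW // trunc_log_ltn.
have t2 : (t < 2 ^ t)%N by rewrite ltn_expl.
have t3 : (2 * t <= 2 ^ t + 2)%N.
  by elim: (t) => // i IH; rewrite expnS; have : (0 < 2 ^ i)%N; [rewrite expn_gt0|lia].
have /andP[b1 b2] := @bin_shift_bounds k t ltac:(lia) ltac:(lia).
rewrite -/b -/r' -/r in b1 b2.
have r0 : (0 < r)%N by rewrite bin_gt0; lia.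
have r4 : (r <= 4 ^ k)%N.
  rewrite /r (_ : 4 ^ k = 2 ^ (2 * k))%N; last by rewrite expnM.
  rewrite -[2%N]/(1 + 1)%N expnDn.
  by rewrite (bigD1 (inord k)) //= inordK ?ltnS ?leq_pmull // !exp1n !muln1 leq_addr.
have kr' : (k * r' <= 2 * r)%N.
  by apply: (@leq_trans (2 * 2 ^ t * r')); [rewrite leq_mul2r kt orbT|rewrite -mulnA leq_mul2l b1].
split.
- by rewrite /b leq_subr andbT; lia.
- apply: leq_trans b2 _; rewrite leq_mul2r; apply/orP; right.
  apply: (@leq_trans (4 ^ t)); first by rewrite leq_expn2r.
  by rewrite (_ : 4 = 2 ^ 2)%N // -expnM mulnC expnM leq_exp2r.
- rewrite /w (_ : 32 * P * k ^ 2 = 16 * (2 * P * k ^ 2))%N; last by lia.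
    rewrite (expnMn 16) leq_mul2r; apply/orP; right.
  apply: (@leq_trans ((4 ^ k) ^ r')); first by rewrite leq_expn2r.
  by rewrite -expnM (_ : 16 = 4 ^ 2)%N // -expnM leq_exp2l.
have q0 : (0 < P * k ^ 2)%N by rewrite muln_gt0 P0 expn_gt0 k0.
have w1 : (32 * P * k ^ 2 <= w)%N.
  by rewrite -{1}(expn1 (32 * P * k ^ 2)) leq_pexp2l // -mulnA muln_gt0.
have w32 : (32 <= w)%N by apply: leq_trans w1; rewrite -mulnA leq_pmulr.
have rw : (r <= w)%N.
  apply: (@leq_trans (2 ^ r)); first by rewrite ltnW // ltn_expl.
  by apply: leq_expn2r; rewrite -mulnA -[2%N]muln1 leq_mul.
have pk : (P * k ^ 4 <= w * w)%N.
  apply: (@leq_trans ((32 * P * k ^ 2) * (32 * P * k ^ 2))); last by rewrite leq_mul.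
  rewrite (_ : k ^ 4 = k ^ 2 * k ^ 2)%N; last by rewrite -expnD.
  apply: (@leq_trans ((P * k ^ 2) * (P * k ^ 2))).
    by rewrite mulnACA leq_mul2r leq_pmulr ?orbT.
  by rewrite -[32 * P * _]mulnA leq_mul // leq_pmull.
have c400 : (400 <= w * w)%N by apply: (@leq_trans (32 * 32)); rewrite ?leq_mul.
have c8 : (8 <= w)%N by apply: leq_trans w32.
(* The exponent 9 is 2 + 2 + 1 + 2 + 2, for the factors 400, 400, 8, P k^4 and r^2. *)
apply: (@leq_trans ((w * w) * ((w * w) * (w * ((w * w) * (w * w)))))).
  do 4!(apply: leq_mul; first by []).
  by rewrite -mulnn leq_mul.
by rewrite !mulnA -{1}(expn1 w) -!expnSr.
Qed.
End BlockSize.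

Local Open Scope ring_scope.

(** * Drift of the exponential potential *)

(** From exp(x) <= 1 / (1 - x) and (1 - x)(1 + x + 2x^2) = 1 + x^2 (1 - 2x). Only an upper bound on
    x enters, so large negative exponents are allowed. *)
Lemma expR_le_quad (R : realType) (x : R) :
  x <= 1 / 2 -> expR x <= 1 + x + 2 * x ^+ 2.
Proof.
move=> xle; have /= h := expR_ge1Dx (- x).
have px : 0 < 1 + - x by lra.
have : expR x <= (1 + - x)^-1.
  by rewrite -[x in expR x]opprK expRN lef_pV2 ?posrE ?expR_gt0.
move=> /le_trans; apply.
rewrite -[leLHS]mul1r ler_pdivrMr //.
have : 0 <= x ^+ 2 * (1 - 2 * x) by apply: mulr_ge0; [exact: sqr_ge0|lra].
rewrite !expr2; lra.
Qed.

Lemma sum_expR_le (R : realType) (B : finType) (S : {set B}) (y : B -> R) :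
  (forall A, A \in S -> y A <= 1 / 2) ->
  \sum_(A in S) y A + 2 * \sum_(A in S) y A ^+ 2 <= 0 ->
  \sum_(A in S) expR (y A) <= #|S|%:R.
Proof.
move=> yle sle; apply: (@le_trans _ _ (\sum_(A in S) (1 + y A + 2 * y A ^+ 2))).
  by apply: ler_sum => A AS; apply: expR_le_quad; exact: yle.
rewrite !big_split /= -mulr_sumr sumr_const -addrA.
by rewrite gerDl.
Qed.

Section Drift.
(* [z] and [h] are the predicted degree and the allowed deviation before a step,
   [z'] and [h'] those after it; [x] is the fraction of points that the step
   covers, [w] the predicted degree in the hypergraph the block is taken from,
   and [L A] the loss of degree when block [A] is taken.  All degrees except [w]
   are normalised by their initial value. *)
Variables (R : realType) (B : finType) (S : {set B}) (L : B -> R).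
Variables (k1 rho w z z' h h' eps x s mu : R).
Hypothesis k1P : 0 <= k1 <= rho.
Hypothesis w0 : 0 < w.
Hypothesis z01 : 0 < z <= 1.
Hypothesis eps01 : 0 < eps <= 1 / 10.
Hypothesis x0 : 0 < x <= s.
Hypothesis rho1 : 1 <= rho.
Hypothesis mu0 : 0 < mu.
Hypothesis s_eps : 4 * rho * s <= eps.
Hypothesis mu_eps : 68 * mu * rho * s <= eps.
Hypothesis hE : h = z * eps.
Hypothesis z'P : z * (1 - k1 * x) <= z' <= z * (1 - k1 * x + rho ^+ 2 * x ^+ 2).
Hypothesis h'P : h * (1 + 10 * rho * x) <= h' <= h * (1 + 22 * rho * x).
Hypothesis LP : forall A, A \in S -> 0 <= L A <= rho * s.
Let f : R := #|S|%:R.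
Hypothesis fP : w * (1 - eps - 2 * x) <= f * x <= w * (1 + eps).
Let t := \sum_(A in S) L A.
Hypothesis t_le : t <= z * w * ((1 + eps) ^+ 2 * k1).

(** Use (c - L)^2 <= 2c^2 + 2L^2 and L^2 <= rho s L, so that the second moment of the loss is
    controlled by its sum [t]. The constants add up to 136 = 2 * 68, whence the 68 in [mu_eps]. *)
Let sum_sqr (c : R) : - (4 * rho * z * x) <= c <= 4 * rho * z * x ->
  2 * \sum_(A in S) (mu * (c - L A)) ^+ 2 <= mu * z * w * (2 * eps * rho).
Proof.
move=> cP.
have cc : c ^+ 2 <= 16 * rho ^+ 2 * z ^+ 2 * x ^+ 2.
  have : 0 <= (4 * rho * z * x - c) * (4 * rho * z * x + c).
    by apply: mulr_ge0; lra.
  rewrite !expr2; lra.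
have one A : A \in S -> (mu * (c - L A)) ^+ 2 <=
    2 * mu ^+ 2 * (rho * s * L A + 16 * rho ^+ 2 * z ^+ 2 * x ^+ 2).
  move=> AS; have LA := LP AS.
  rewrite exprMn [2 * mu ^+ 2]mulrC -[_ * 2 * _]mulrA.
  apply: ler_wpM2l; first exact: sqr_ge0.
  have h1 : L A ^+ 2 <= rho * s * L A by rewrite expr2; apply: ler_wpM2r; lra.
  have := sqr_ge0 (c + L A); rewrite !expr2 in cc h1 *; lra.
have r1 := rho1; have m0 := mu0; have se := s_eps; have me := mu_eps.
have [k10 k1r] := andP k1P; have [z0 z1] := andP z01.
have [e0 e1] := andP eps01; have [x0' xs] := andP x0.
have s0 : 0 < s by lra.
apply: (@le_trans _ _ (2 * (2 * mu ^+ 2 * (rho * s * t + 16 * rho ^+ 2 * z ^+ 2 * x ^+ 2 * f)))).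
  rewrite ler_pM2l; last by lra.
  apply: le_trans (ler_sum _ one) _.
  rewrite -/f -/t -mulr_sumr big_split /= -mulr_sumr sumr_const -[_ *+ #|_|]mulr_natr.
  exact: lexx.
have zw0 : 0 < z * w by apply: mulr_gt0.
have t2 : t <= 2 * rho * (z * w).
  apply: le_trans t_le _; rewrite [2 * _ * _]mulrC ler_pM2l //.
  apply: (@le_trans _ _ (2 * k1)); last by lra.
  by apply: ler_wpM2r => //; rewrite expr2; nra.
have fx : z ^+ 2 * x ^+ 2 * f <= 2 * s * (z * w).
  have -> : z ^+ 2 * x ^+ 2 * f = z * x * (z * (f * x)) by ring.
  have -> : 2 * s * (z * w) = s * (z * (2 * w)) by ring.
  apply: ler_pM.
  - by rewrite mulr_ge0 // ltW.
  - by rewrite !mulr_ge0 ?ler0n // ltW.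
  - by apply: le_trans xs; rewrite ler_piMl // ltW.
  rewrite ler_pM2l //; have [_ f2] := andP fP; apply: le_trans f2 _.
  by rewrite [2 * w]mulrC ler_pM2l //; lra.
have rho0 : 0 < rho by lra.
have rs0 : 0 < rho * s by apply: mulr_gt0.
have h1 : rho * s * t <= rho * s * (2 * rho * (z * w)) by rewrite ler_pM2l.
have h2 : 16 * rho ^+ 2 * z ^+ 2 * x ^+ 2 * f <= 16 * rho ^+ 2 * (2 * s * (z * w)).
  rewrite -mulrA -[_ * z ^+ 2 * _]mulrA [z ^+ 2 * _]mulrA.
  by rewrite ler_wpM2l // mulr_ge0 // exprn_ge0 // ltW.
apply: (@le_trans _ _ (mu * (z * w) * (2 * rho) * (68 * mu * rho * s))).
  have : 2 * mu ^+ 2 * (rho * s * t + 16 * rho ^+ 2 * z ^+ 2 * x ^+ 2 * f) <=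
     2 * mu ^+ 2 * (rho * s * (2 * rho * (z * w)) + 16 * rho ^+ 2 * (2 * s * (z * w))).
    by rewrite ler_pM2l ?lerD // mulr_gt0 ?exprn_gt0.
  rewrite !expr2; lra.
have -> : mu * z * w * (2 * eps * rho) = mu * (z * w) * (2 * rho) * eps by ring.
by rewrite ler_pM2l // !mulr_gt0 //; lra.
Qed.

Let increment_bound a : z - z' - (h' - h) <= a <= z - z' + (h' - h) ->
  - (4 * rho * z * x) <= a <= 4 * rho * z * x.
Proof.
move=> aP.
have r1 := rho1; have m0 := mu0; have se := s_eps; have me := mu_eps.
have [k10 k1r] := andP k1P; have [z0 z1] := andP z01.
have [e0 e1] := andP eps01; have [x0' xs] := andP x0.
have [z'1 z'2] := andP z'P; have [h'1 h'2] := andP h'P; have [f1 f2] := andP fP.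
have zw0 : 0 < z * w by apply: mulr_gt0.
have rho0 : 0 < rho by exact: lt_le_trans rho1.
have [ge_z ge_w ge_eps ge_x ge_rho] :
  [/\ 0 <= z, 0 <= w, 0 <= eps, 0 <= x & 0 <= rho] by split; exact: ltW.
have rx : rho * x <= 1 / 40.
  by have : rho * x <= rho * s; [rewrite ler_pM2l | lra].
have rx0 : 0 < rho * x by apply: mulr_gt0.
have x1 : x <= 1 / 40 by apply: le_trans rx; rewrite ler_peMl.
have zrx0 : 0 < z * (rho * x) by apply: mulr_gt0.
have zk : 0 <= z * (k1 * x) <= z * (rho * x).
  apply/andP; split; first by rewrite !mulr_ge0.
  by rewrite ler_pM2l // ler_pM2r.
have zr2 : z * (rho ^+ 2 * x ^+ 2) <= z * (rho * x).
  by rewrite ler_pM2l // -exprMn expr2 ler_piMl ?ltW //; lra.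
have her : 0 <= h * (rho * x) <= z * (rho * x) / 10.
  rewrite hE; apply/andP; split; first by rewrite !mulr_ge0.
  have -> : z * eps * (rho * x) = z * (rho * x) * eps by ring.
  by rewrite ler_pM2l //; lra.
by apply/andP; split; lra.
Qed.

(** In units of mu z w, the growth of the allowed deviation gains at least 7 eps rho. The
    uncertainty of the mean loss costs at most 3 eps k1 + 2c and the second moment 2 eps rho, which
    is less altogether. *)
Lemma drift_upper c : t >= z * w * ((1 - eps) ^+ 2 * k1 - 2 * c) ->
  2 * c <= eps * rho ->
  \sum_(A in S) expR (mu * (z - z' - (h' - h) - L A)) <= f.
Proof.
move=> t_ge c_eps; set a := z - z' - (h' - h).
have r1 := rho1; have m0 := mu0; have se := s_eps; have me := mu_eps.
have [k10 k1r] := andP k1P; have [z0 z1] := andP z01.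
have [e0 e1] := andP eps01; have [x0' xs] := andP x0.
have [z'1 z'2] := andP z'P; have [h'1 h'2] := andP h'P; have [f1 f2] := andP fP.
have zw0 : 0 < z * w by apply: mulr_gt0.
have rho0 : 0 < rho by exact: lt_le_trans rho1.
have [ge_z ge_w ge_eps ge_x ge_rho] :
  [/\ 0 <= z, 0 <= w, 0 <= eps, 0 <= x & 0 <= rho] by split; exact: ltW.
have h_le : h <= h'.
  apply: le_trans h'1; rewrite ler_peMr ?hE ?mulr_ge0 // lerDl.
  by rewrite !mulr_ge0.
have rx0 : 0 < rho * x by apply: mulr_gt0.
have a4 : - (4 * rho * z * x) <= a <= 4 * rho * z * x.
  by apply: increment_bound; rewrite /a; apply/andP; split; lra.
have rs : rho * s <= 1 / 40 by lra.
have x1 : x <= 1 / 40.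
  apply: (le_trans _ rs); apply: (@le_trans _ _ (rho * x)); first by rewrite ler_peMl.
  by rewrite ler_pM2l.
apply: sum_expR_le => [A AS|].
  have LA := LP AS.
  have : mu * (a - L A) <= mu * (4 * rho * s).
    rewrite ler_pM2l //; apply: le_trans (_ : 4 * rho * z * x <= _); first by lra.
    have : z * (rho * x) <= 1 * (rho * s).
      by apply: ler_pM; rewrite ?ler_pM2l // ltW.
    lra.
  lra.
apply: le_trans (lerD (lexx _) (sum_sqr a4)) _.
rewrite -mulr_sumr sumrB sumr_const -[a *+ _]mulr_natr -/f -/t.
rewrite -[mu * z * w]mulrA -[mu * _ * _]mulrA -mulrDr.
apply: mulr_ge0_le0; first exact: ltW.
have fa : a * f <= z * w * ((1 + eps) * k1 - 7 * eps * rho).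
  apply: (@le_trans _ _ ((f * x) * (z * k1) - (f * x) * (10 * z * eps * rho))).
    have fx0 : 0 <= f by rewrite ler0n.
    apply: (@le_trans _ _ ((z * (k1 * x) - 10 * h * (rho * x)) * f)).
      by rewrite ler_wpM2r // /a; lra.
    by rewrite hE; lra.
  have i1 : (f * x) * (z * k1) <= w * (1 + eps) * (z * k1).
    by rewrite ler_wpM2r // mulr_ge0 //; lra.
  have i2 : w * (7 / 10) * (10 * z * eps * rho) <= (f * x) * (10 * z * eps * rho).
    rewrite ler_wpM2r //; first by rewrite !mulr_ge0.
    by apply: le_trans f1; rewrite ler_pM2l //; lra.
  lra.
have : 0 <= z * w * (4 * eps * rho - 2 * c - 3 * eps * k1 + eps * eps * k1 + eps * rho).
  rewrite mulr_ge0 //; first exact: ltW.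
  have : 0 <= eps * (rho - k1) by rewrite !mulr_ge0 // subr_ge0.
  have : 0 <= eps * eps * k1 by rewrite !mulr_ge0.
  have : 0 <= eps * rho by rewrite mulr_ge0.
  lra.
rewrite expr2 in t_ge.
lra.
Qed.

(** The same balance with the sign of the deviation reversed. The further errors 2 x k1, from the
    number of blocks, and 2 rho^2 x, from the curvature of the trajectory, are absorbed through
    [s_eps]. *)
Lemma drift_lower :
  \sum_(A in S) expR (mu * (L A - (z - z' + (h' - h)))) <= f.
Proof.
set a := z - z' + (h' - h).
have r1 := rho1; have m0 := mu0; have se := s_eps; have me := mu_eps.
have [k10 k1r] := andP k1P; have [z0 z1] := andP z01.
have [e0 e1] := andP eps01; have [x0' xs] := andP x0.
have [z'1 z'2] := andP z'P; have [h'1 h'2] := andP h'P; have [f1 f2] := andP fP.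
have zw0 : 0 < z * w by apply: mulr_gt0.
have rho0 : 0 < rho by exact: lt_le_trans rho1.
have [ge_z ge_w ge_eps ge_x ge_rho] :
  [/\ 0 <= z, 0 <= w, 0 <= eps, 0 <= x & 0 <= rho] by split; exact: ltW.
have h_le : h <= h'.
  apply: le_trans h'1; rewrite ler_peMr ?hE ?mulr_ge0 // lerDl.
  by rewrite !mulr_ge0.
have rx0 : 0 < rho * x by apply: mulr_gt0.
have a4 : - (4 * rho * z * x) <= a <= 4 * rho * z * x.
  by apply: increment_bound; rewrite /a; apply/andP; split; lra.
have rs : rho * s <= 1 / 40 by lra.
have x1 : x <= 1 / 40.
  apply: (le_trans _ rs); apply: (@le_trans _ _ (rho * x)); first by rewrite ler_peMl.
  by rewrite ler_pM2l.
under eq_bigr => A _ do rewrite -opprB.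
have flip A : (mu * - (a - L A)) ^+ 2 = (mu * (a - L A)) ^+ 2.
  by rewrite mulrN sqrrN.
apply: sum_expR_le => [A AS|].
  have LA := LP AS.
  have : mu * (L A - a) <= mu * (5 * rho * s).
    rewrite ler_pM2l //; apply: le_trans (_ : rho * s + 4 * rho * z * x <= _); first by lra.
    have : z * (rho * x) <= 1 * (rho * s).
      by apply: ler_pM; rewrite ?ler_pM2l // ltW.
    lra.
  lra.
under [X in _ + 2 * X]eq_bigr => A _ do rewrite flip.
apply: le_trans (lerD (lexx _) (sum_sqr a4)) _.
rewrite -mulr_sumr sumrN sumrB sumr_const -[a *+ _]mulr_natr -/f -/t opprB.
rewrite -[mu * z * w]mulrA -[mu * _ * _]mulrA -mulrDr.
apply: mulr_ge0_le0; first exact: ltW.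
have fx0 : 0 <= f * x by rewrite mulr_ge0 ?ler0n.
have fa : a * f >= z * w * ((1 - eps - 2 * x) * k1 - 2 * rho ^+ 2 * x + 7 * eps * rho).
  have i1 : w * (1 - eps - 2 * x) * (z * k1) <= (f * x) * (z * k1).
    by rewrite ler_wpM2r // mulr_ge0 //; lra.
  have i2 : w * (7 / 10) * (10 * z * eps * rho) <= (f * x) * (10 * z * eps * rho).
    rewrite ler_wpM2r //; first by rewrite !mulr_ge0.
    by apply: le_trans f1; rewrite ler_pM2l //; lra.
  have i3 : (f * x) * (z * rho ^+ 2 * x) <= (w * 2) * (z * rho ^+ 2 * x).
    rewrite ler_wpM2r //.
      by rewrite !mulr_ge0 ?exprn_ge0.
    by apply: le_trans f2 _; rewrite ler_pM2l //; lra.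
  apply: (@le_trans _ _ ((z * (k1 * x) - z * (rho ^+ 2 * x ^+ 2) + 10 * h * (rho * x)) * f)).
    rewrite hE !expr2 in i3 *; lra.
  by rewrite ler_wpM2r ?ler0n // /a; lra.
have : 0 <= z * w * (5 * eps * rho - 3 * eps * k1 - eps * eps * k1 - 2 * x * k1 - 2 * rho ^+ 2 * x).
  rewrite mulr_ge0 //; first exact: ltW.
  have i1 : eps * k1 <= eps * rho by rewrite ler_pM2l.
  have i2 : eps * eps * k1 <= 1 / 10 * (eps * rho).
    by rewrite -mulrA; apply: ler_pM; rewrite ?mulr_ge0.
  have i3 : rho * (rho * x) <= rho * (rho * s) by rewrite !ler_pM2l.
  have i4 : rho * (4 * rho * s) <= rho * eps by rewrite ler_pM2l.
  have i5 : x * k1 <= x * rho by rewrite ler_pM2l.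
  have i6 : rho * x <= rho * rho * x by rewrite ler_pM2r // ler_peMl.
  rewrite expr2; lra.
have tl := t_le; rewrite !expr2 in tl fa *.
lra.
Qed.
End Drift.

(** * Bernoulli-type bounds for one step of the trajectory *)

Lemma expr_1B_bounds (R : realFieldType) (x : R) n : 0 <= x <= 1 ->
  1 - n%:R * x <= (1 - x) ^+ n <= 1 - n%:R * x + n%:R ^+ 2 * x ^+ 2.
Proof.
move=> /andP[x0 x1]; elim: n => [|n /andP[IH1 IH2]]; first by rewrite expr0 !mul0r expr0n /=; lra.
have n0 : 0 <= n%:R :> R by rewrite ler0n.
have p1 : (1 - x) ^+ n <= 1 by apply: exprn_ile1; lra.
rewrite exprS -natr1.
have h0 : 0 <= 1 - x by lra.
have h1 := ler_wpM2l x0 p1; have h2 := ler_wpM2l x0 IH1.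
have h3 : 0 <= n%:R * x ^+ 2 by rewrite mulr_ge0 // sqr_ge0.
have h4 := sqr_ge0 x.
by rewrite !expr2 in h3 h4 IH2 *; apply/andP; split; lra.
Qed.

(** Below: Bernoulli for (1 + x)^n together with (1 + x)(1 - x) <= 1. Above: Bernoulli for (1 - x)^n
    together with (1 + 2y)(1 - y) >= 1 for y = nx <= 1/2. *)
Lemma expr_1B_inv_bounds (R : realFieldType) (x : R) n :
  0 <= x < 1 -> n%:R * x <= 1 / 2 ->
  1 + n%:R * x <= (1 - x) ^- n <= 1 + 2 * n%:R * x.
Proof.
move=> /andP[x0 x1] nx.
have /andP[b1 _] : 1 - n%:R * x <= (1 - x) ^+ n <= 1 - n%:R * x + n%:R ^+ 2 * x ^+ 2.
  by apply: expr_1B_bounds; lra.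
have nx0 : 0 <= n%:R * x by rewrite mulr_ge0.
have p0 : 0 < (1 - x) ^+ n by rewrite exprn_gt0 // subr_gt0.
apply/andP; split.
  have : (1 + x) ^+ n * (1 - x) ^+ n <= 1.
    by rewrite -exprMn; apply: exprn_ile1; have := sqr_ge0 x; rewrite ?expr2; nra.
  rewrite -ler_pdivlMr // div1r; apply: le_trans.
  elim: n {nx b1 nx0 p0} => [|n IH]; first by rewrite expr0 mul0r addr0.
  rewrite exprS -natr1; have x1' : 0 <= 1 + x by lra.
  have := ler_wpM2l x1' IH; have : 0 <= n%:R * (x * x) by rewrite !mulr_ge0.
  lra.
rewrite -div1r ler_pdivrMr //.
apply: (@le_trans _ _ ((1 + 2 * n%:R * x) * (1 - n%:R * x))); last first.
  by rewrite ler_wpM2l //; lra.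
have : 0 <= (n%:R * x) * (1 - 2 * (n%:R * x)) by rewrite mulr_ge0 //; lra.
lra.
Qed.

(** * Number of available blocks and total loss of degree in one step *)

Section Local.
Variables (R : realType) (V B : finType) (inc : B -> {set V}).

(** Supplies the hypotheses of the drift lemmas. By [sum_hit] the total loss is a sum over the
    blocks [b] through [T]; for each, the blocks meeting [b] number about r - 1 times the typical
    degree, up to the Bonferroni error rho^2 s D0. Discarding the blocks through [T] from the full
    ones costs the 2x. *)
Lemma hit_bounds (F0 F : {set B}) (U : {set V}) (q r rho : nat) (T : V)
    (D0 D z0 z eps s : R) (S := [set A in full inc F0 U | T \notin inc A])
    (L := fun A => (hit inc F U T A)%:R / D) (w := D0 * z0)
    (x := q%:R / #|U|%:R) :
  T \in U ->
  (forall A, A \in F0 -> #|inc A| = q) -> (forall A, A \in F -> #|inc A| = r) ->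
  (0 < r <= rho)%N -> (0 < q <= rho)%N ->
  0 < D0 -> 0 < D -> 0 < z0 -> 0 < z -> 0 < eps <= 1 / 10 -> 0 < s ->
  (forall T1 T2, T1 != T2 -> (codeg inc F0 T1 T2)%:R <= s * D0) ->
  (forall T1 T2, T1 != T2 -> (codeg inc F T1 T2)%:R <= s * D) ->
  (forall T', T' \in U ->
     w * (1 - eps) <= (deg inc F0 U T')%:R <= w * (1 + eps)) ->
  (z * (1 - eps) <= (deg inc F U T)%:R / D <= z * (1 + eps)) ->
  [/\ forall A, A \in S -> 0 <= L A <= rho%:R * s,
      w * (1 - eps - 2 * x) <= #|S|%:R * x <= w * (1 + eps),
      \sum_(A in S) L A <= z * w * ((1 + eps) ^+ 2 * r.-1%:R) &
      z * w * ((1 - eps) ^+ 2 * r.-1%:R - 2 * (rho%:R ^+ 2 * s / z0))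
        <= \sum_(A in S) L A].
Proof.
move=> TU F0q Fr /andP[r0 rrho] /andP[q0 qrho] D0_0 D_0 z0_0 z_0 epsP s0.
move=> cF0 cF dF0 dF.
have w0 : 0 < w by rewrite mulr_gt0.
have [eps0 eps1] := andP epsP.
have U0 : (0 < #|U|)%N by apply/card_gt0P; exists T.
have x0 : 0 < x by rewrite divr_gt0 ?ltr0n.
have sT : (#|S| + deg inc F0 U T = #|full inc F0 U|)%N.
  rewrite -(cardsID [set A | T \in inc A] (full inc F0 U)) addnC.
  congr (_ + _)%N; apply: eq_card => A; rewrite !inE //.
  by rewrite andbC.
have fullx : #|full inc F0 U|%:R * x = (\sum_(T' in U) (deg inc F0 U T')%:R) / #|U|%:R :> R.
  rewrite -natr_sum (sum_deg U F0q) natrM /x; ring.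
have f_hi : #|full inc F0 U|%:R * x <= w * (1 + eps).
  rewrite fullx ler_pdivrMr ?ltr0n // mulr_natr -sumr_const.
  by apply: ler_sum => T' /dF0 /andP[].
have f_lo : w * (1 - eps) <= #|full inc F0 U|%:R * x.
  rewrite fullx ler_pdivlMr ?ltr0n // mulr_natr -sumr_const.
  by apply: ler_sum => T' /dF0 /andP[].
have /andP[dT1 dT2] := dF0 _ TU; have /andP[d1 d2] := dF.
have SE : #|S|%:R = #|full inc F0 U|%:R - (deg inc F0 U T)%:R :> R.
  by rewrite -sT natrD addrK.
pose t0 : R := \sum_(b in full inc F U | T \in inc b)
  #|[set A in full inc F0 U | (T \notin inc A) && ~~ [disjoint inc b & inc A]]|%:R.
have tE : \sum_(A in S) L A = t0 / D.
  rewrite /L -mulr_suml -natr_sum; congr (_ / D).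
  rewrite /t0 -natr_sum -sum_hit; congr (_%:R).
  by apply: eq_bigl => A; rewrite inE.
have dE (y : R) : \sum_(b in full inc F U | T \in inc b) y = (deg inc F U T)%:R * y.
  rewrite sumr_const mulr_natl; congr (_ *+ _).
  by apply: eq_card => b; rewrite inE.
have cS b : b \in full inc F U -> T \in inc b -> #|inc b :\ T| = r.-1.
  rewrite inE => /andP[/Fr <- _] Tb.
  by rewrite [in RHS](cardsD1 T) Tb.
have sU b : b \in full inc F U -> forall T', T' \in inc b :\ T -> T' \in U.
  by rewrite inE => /andP[_ /fintype.subsetP sb] T'; rewrite inE => /andP[_ /sb].
split.
- move=> A; rewrite inE => /andP[AF TA]; rewrite divr_ge0 ?ler0n ?(ltW D_0) //=.
    rewrite /L ler_pdivrMr // -mulrA.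
  have AF0 : A \in F0 by move: AF; rewrite inE => /andP[].
  (* The codegree bound is real, whereas [hit_le] takes a natural number: the largest codegree
     serves. *)
  pose c := \max_(T' | T' != T) codeg inc F T T'.
  have cc : (c%:R : R) <= s * D.
    rewrite /c; elim/big_ind: _ => [|a b ha hb|T' T'T].
    - by rewrite mulr_ge0 // ltW.
    - by rewrite /maxn; case: ifP.
    - by apply: cF; rewrite eq_sym.
  apply: (@le_trans _ _ (#|inc A| * c)%:R).
    rewrite ler_nat; apply: hit_le => // T' T'T.
    by apply: (leq_bigmax_cond (F := fun T' => codeg inc F T T')).
  rewrite natrM; apply: ler_pM; rewrite ?ler0n // F0q //.
  by rewrite ler_nat.
- rewrite SE mulrBl.
  have : 0 <= (deg inc F0 U T)%:R * x <= w * (1 + eps) * x.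
    by rewrite mulr_ge0 ?ler0n ?(ltW x0) //= ler_wpM2r // ltW.
  have : 0 <= w * x * (1 - eps) by rewrite !mulr_ge0 ?(ltW w0) ?(ltW x0) //; lra.
  by move=> ? /andP[? ?]; apply/andP; split; lra.
- rewrite tE ler_pdivrMr //.
  apply: (@le_trans _ _ ((deg inc F U T)%:R * (r.-1%:R * (w * (1 + eps))))).
    rewrite -dE; apply: ler_sum => b /andP[bF Tb].
    apply: le_trans (_ : (\sum_(T' in inc b :\ T) deg inc F0 U T')%:R <= _).
      by rewrite ler_nat; exact: card_meeting_le.
    rewrite natr_sum -(cS b) // mulr_natl -sumr_const.
    by apply: ler_sum => T' /(sU b bF) /dF0 /andP[].
  move: d2; rewrite ler_pdivrMr // => d2.
  have k0 : 0 <= r.-1%:R * (w * (1 + eps)).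
    by rewrite !mulr_ge0 ?ler0n ?(ltW w0) //; lra.
  have := ler_wpM2r k0 d2.
  by rewrite expr2; lra.
- rewrite tE ler_pdivlMr //.
  apply: (@le_trans _ _ ((deg inc F U T)%:R * (r.-1%:R * (w * (1 - eps)) - rho%:R ^+ 2 * (s * D0)))).
    move: d1 d2; rewrite ler_pdivlMr // ler_pdivrMr // => d1 d2.
    have k0 : 0 <= r.-1%:R * (w * (1 - eps)).
      by rewrite !mulr_ge0 ?ler0n ?(ltW w0) //; lra.
    have k1 : 0 <= rho%:R ^+ 2 * (s * D0) by rewrite !mulr_ge0 ?exprn_ge0 ?ler0n ?(ltW s0) ?(ltW D0_0).
    have := ler_wpM2r k0 d1; have := ler_wpM2r k1 d2.
    have : 0 <= (1 - eps) * z * D * (rho%:R ^+ 2 * (s * D0)).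
      by rewrite mulr_ge0 ?k1 // !mulr_ge0 ?(ltW z_0) ?(ltW D_0) //; lra.
    have -> : z * w * ((1 - eps) ^+ 2 * r.-1%:R - 2 * (rho%:R ^+ 2 * s / z0)) * D
      = z * w * D * ((1 - eps) ^+ 2 * r.-1%:R) - 2 * z * D * (rho%:R ^+ 2 * (s * D0)).
      by rewrite /w; field; rewrite gt_eqF.
    by rewrite !expr2; lra.
  rewrite -dE; apply: ler_sum => b /andP[bF Tb].
  pose c := \max_(P : V * V | P.1 != P.2) codeg inc F0 P.1 P.2.
  have cc : (c%:R : R) <= s * D0.
    rewrite /c; elim/big_ind: _ => [|a a' ha hb|[T1 T2] /= ne].
    - by rewrite mulr_ge0 // ltW.
    - by rewrite /maxn; case: ifP.
    - exact: cF0.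
  have mg : (\sum_(T' in inc b :\ T) deg inc F0 U T' <=
     #|[set A in full inc F0 U | (T \notin inc A) && ~~ [disjoint inc b & inc A]]|
      + #|inc b| ^ 2 * c)%N.
    apply: card_meeting_ge => // T1 T2 ne.
    exact: (leq_bigmax_cond (F := fun P => codeg inc F0 P.1 P.2) (T1, T2)).
  have bF' : b \in F by move: bF; rewrite inE => /andP[].
  move: mg; rewrite (Fr b) // -(ler_nat R) natrD natrM natrX => mg.
  have h1 : r%:R ^+ 2 * c%:R <= rho%:R ^+ 2 * (s * D0) :> R.
    by apply: ler_pM; rewrite ?exprn_ge0 ?ler0n // lerXn2r ?nnegrE ?ler0n ?ler_nat.
  have h2 : r.-1%:R * (w * (1 - eps)) <= (\sum_(T' in inc b :\ T) deg inc F0 U T')%:R.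
    rewrite natr_sum -(cS b) // mulr_natl -sumr_const.
    by apply: ler_sum => T' /(sU b bF) /dF0 /andP[].
  lra.
Qed.
End Local.

(** The absolute tolerance [mean_deg * rel_err] varies as m^-(11 rho - (rk - 1)); these bounds on
    the exponent yield the factors 10 and 22 of the drift section. *)
Lemma sub11_bounds k rho : (k <= rho)%N ->
  [/\ k <= 11 * rho, 10 * rho <= 11 * rho - k & 11 * rho - k <= 11 * rho]%N.
Proof. by move=> ?; split; lia. Qed.

(** [b] stands for the indicator of [A \notin C] that [cardsU1] produces. *)
Lemma greedy_count (b : bool) c q m M : (c * q + m <= M)%N -> (q <= m)%N ->
  ((b + c) * q + (m - q) <= M)%N.
Proof. by case: b => /= *; nia. Qed.

Lemma sub_fuel q m n : (m <= n.+1)%N -> (0 < q)%N -> (m - q <= n)%N.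
Proof. by lia. Qed.

(** * The greedy packing *)

Section RandomGreedy.
Variables (R : realType) (V B : finType) (inc : B -> {set V}) (I : finType).
Variables (F : I -> {set B}) (rk : I -> nat) (D : I -> R) (i0 : I).
Variables (rho m0 : nat) (eps0 mu s : R).

(* The relative error grows like (m0 / m)^(11 rho): any exponent exceeding the
   drift of the relative deviations by a constant factor would do. *)
Definition mean_deg i (m : nat) : R := (m%:R / m0%:R) ^+ (rk i).-1.
Definition rel_err (m : nat) : R := eps0 * (m0%:R / m%:R) ^+ (11 * rho).
Definition norm_deg i U T : R := (deg inc (F i) U T)%:R / D i.
(** One exponential for each side of the tube around the trajectory; each exceeds 1 exactly when the
    degree leaves the tube on that side. *)
Definition pot_at i (U : {set V}) T : R :=
  expR (mu * (norm_deg i U T - mean_deg i #|U| - mean_deg i #|U| * rel_err #|U|))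
  + expR (mu * (mean_deg i #|U| - mean_deg i #|U| * rel_err #|U| - norm_deg i U T)).
(** Summing over all families lets one choice of block from [F i0] keep the degrees in the other
    families under control too. *)
Definition potential (U : {set V}) : R := \sum_i \sum_(T in U) pot_at i U T.

(** All terms are nonnegative, so each exponential is at most 1 and its exponent at most 0. *)
Lemma potential_bound U i T : 0 < mu -> potential U <= 1 -> T \in U ->
  mean_deg i #|U| * (1 - rel_err #|U|) <= norm_deg i U T
    <= mean_deg i #|U| * (1 + rel_err #|U|).
Proof.
move=> mu0 Phi TU.
have p0 j T' : 0 <= pot_at j U T' by rewrite addr_ge0 ?expR_ge0.
have : pot_at i U T <= 1.
  apply: le_trans Phi; rewrite /potential (bigD1 i) //= (bigD1 T) //= -addrA.
  rewrite lerDl addr_ge0 ?sumr_ge0 // => j _; exact: sumr_ge0.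
rewrite /pot_at; set a := expR _; set b := expR _ => ab.
have a1 : a <= 1 by apply: le_trans ab; rewrite lerDl expR_ge0.
have b1 : b <= 1 by apply: le_trans ab; rewrite lerDr expR_ge0.
move: a1 b1; rewrite /a /b !(pmulr_rle0, expR_le1) //.
by move=> ? ?; apply/andP; split; lra.
Qed.

Hypothesis Frk : forall i b, b \in F i -> #|inc b| = rk i.
Hypothesis rkP : forall i, (0 < rk i <= rho)%N.
Hypothesis D_gt0 : forall i, 0 < D i.
Hypothesis codegP : forall i T1 T2, T1 != T2 ->
  (codeg inc (F i) T1 T2)%:R <= s * D i.
Hypothesis s_gt0 : 0 < s.
Hypothesis mu_gt0 : 0 < mu.
Hypothesis eps0_gt0 : 0 < eps0.
Hypothesis s_eps : 4 * rho%:R * s <= eps0.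
Hypothesis mu_eps : 68 * mu * rho%:R * s <= eps0.

Section Step.
Variable U : {set V}.
Hypothesis Um0 : (0 < #|U| <= m0)%N.
Hypothesis xs : (rk i0)%:R / #|U|%:R <= s.
Hypothesis ef1 : rel_err #|U| <= 1 / 10.
Hypothesis s_z : 2 * rho%:R * s <= mean_deg i0 #|U| * eps0.
Hypothesis PhiU : potential U <= 1.

Let G := full inc (F i0) U.

Lemma rho_gt0 : (1 <= rho%:R :> R).
Proof. by rewrite ler1n; case/andP: (rkP i0); apply: leq_trans. Qed.

Lemma rel_err_ge : eps0 <= rel_err #|U|.
Proof.
case/andP: Um0 => U0 Um.
rewrite /rel_err ler_peMr ?(ltW eps0_gt0) // exprn_ege1 //.
by rewrite ler_pdivlMr ?ltr0n // mul1r ler_nat.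
Qed.

Lemma mean_deg_gt0 i : 0 < mean_deg i #|U|.
Proof.
case/andP: Um0 => U0 Um.
by rewrite exprn_gt0 // divr_gt0 ?ltr0n // (leq_trans U0).
Qed.

Lemma mean_deg_le1 i : mean_deg i #|U| <= 1.
Proof.
case/andP: Um0 => U0 Um.
rewrite exprn_ile1 ?divr_ge0 ?ler0n // ler_pdivrMr ?ltr0n ?(leq_trans U0) //.
by rewrite mul1r ler_nat.
Qed.

(** After the step each exponential is its old value times the exponential of an increment; the
    drift lemmas bound the sum of these factors by the number of blocks avoiding [T]. *)
Lemma pot_at_step i T : T \in U ->
  \sum_(A in G | T \notin inc A) pot_at i (U :\: inc A) T <= #|G|%:R * pot_at i U T.
Proof.
move=> TU.
have [U0 Um] := andP Um0; have m00 : (0 < m0)%N := leq_trans U0 Um.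
have rkr : ((rk i).-1 <= rho)%N.
  by apply: leq_trans (leq_pred _) _; case/andP: (rkP i).
have [rki N1 N2] := sub11_bounds rkr.
have rho1 := rho_gt0; have efge := rel_err_ge.
have e0 := eps0_gt0; have s0 := s_gt0; have se := s_eps; have me := mu_eps.
have mu0 := mu_gt0.
have ef0 : 0 < rel_err #|U| <= 1 / 10 by rewrite ef1 andbT; lra.
have [q0 qrho] := andP (rkP i0).
set q := rk i0 in q0 qrho.
set m := #|U|; set x : R := q%:R / m%:R.
have x0 : 0 < x by rewrite divr_gt0 ?ltr0n.
have rs : rho%:R * s <= 1 / 40 by have /andP[_ ?] := ef0; lra.
have rx : rho%:R * x <= 1 / 40.
  by apply: le_trans rs; rewrite ler_wpM2l ?ler0n.
have x1 : x <= 1 / 40 by apply: le_trans rx; rewrite ler_peMl // ltW.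
have qm : (q <= m)%N.
  have : x <= 1 by lra.
  by rewrite ler_pdivrMr ?ltr0n // mul1r ler_nat.
have [S_L S_f S_t S_t'] := hit_bounds (D0 := D i0) (D := D i) (z0 := mean_deg i0 m)
  (z := mean_deg i m) (eps := rel_err m) (s := s) TU (Frk (i := i0)) (Frk (i := i)) (rkP i) (rkP i0)
  (D_gt0 i0) (D_gt0 i) (mean_deg_gt0 i0) (mean_deg_gt0 i) ef0 s_gt0 (@codegP i0) (@codegP i)
  (fun T' T'U => ltac:(
     have := potential_bound i0 mu_gt0 PhiU T'U;
     rewrite /norm_deg ler_pdivlMr // ler_pdivrMr // -/m;
     rewrite [_ * D i0]mulrC [_ * _ * D i0]mulrC !mulrA; exact))
  (potential_bound i mu_gt0 PhiU TU).
set S := [set A in _ | _] in S_L S_f S_t S_t'.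
have cardU A : A \in S -> #|U :\: inc A| = (m - q)%N.
  rewrite !inE => /andP[/andP[AF sA] _].
  by rewrite cardsDS // (Frk AF).
have m'E : (m - q)%:R = m%:R * (1 - x) :> R.
  by rewrite natrB // /x; field; rewrite gt_eqF // ltr0n.
pose z := mean_deg i m; pose z' := mean_deg i (m - q).
pose h := z * rel_err m; pose h' := z' * rel_err (m - q).
have z'E : z' = z * (1 - x) ^+ (rk i).-1.
  by rewrite /z' /z /mean_deg m'E mulrAC exprMn.
have h'E : h' = h * (1 - x) ^- (11 * rho - (rk i).-1).
  have xn : (1 - x) != 0 by rewrite gt_eqF //; lra.
  have -> : (1 - x) ^- (11 * rho - (rk i).-1) = (1 - x) ^+ (rk i).-1 / (1 - x) ^+ (11 * rho).
    by rewrite -{2}(subnKC rki) exprD invfM mulrA divff ?mul1r // expf_neq0.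
  rewrite /h' /h z'E /rel_err m'E invfM [m0%:R * _]mulrA [in LHS]exprMn exprVn; ring.
have z'P : z * (1 - (rk i).-1%:R * x) <= z' <=
    z * (1 - (rk i).-1%:R * x + rho%:R ^+ 2 * x ^+ 2).
  have /andP[b1 b2] : 1 - (rk i).-1%:R * x <= (1 - x) ^+ (rk i).-1 <=
     1 - (rk i).-1%:R * x + (rk i).-1%:R ^+ 2 * x ^+ 2 by apply: expr_1B_bounds; lra.
  rewrite z'E !ler_pM2l ?mean_deg_gt0 // b1; apply: le_trans b2 _.
  by rewrite lerD2l ler_wpM2r ?sqr_ge0 // lerXn2r ?nnegrE ?ler0n // ler_nat.
have h0 : 0 < h by rewrite mulr_gt0 ?mean_deg_gt0 //; case/andP: ef0.
have h'P : h * (1 + 10 * rho%:R * x) <= h' <= h * (1 + 22 * rho%:R * x).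
  set N := (11 * rho - (rk i).-1)%N in N1 N2 h'E.
  have N1x : 10 * rho%:R * x <= N%:R * x.
    by rewrite ler_wpM2r ?(ltW x0) // -natrM ler_nat.
  have N2x : N%:R * x <= 11 * rho%:R * x.
    by rewrite ler_wpM2r ?(ltW x0) // -natrM ler_nat.
  have /andP[b1 b2] : 1 + N%:R * x <= (1 - x) ^- N <= 1 + 2 * N%:R * x.
    by apply: expr_1B_inv_bounds; lra.
  by rewrite h'E !ler_pM2l //; apply/andP; split; lra.
have k1P : 0 <= ((rk i).-1%:R : R) <= rho%:R.
  by rewrite ler0n ler_nat.
have w0 : 0 < D i0 * mean_deg i0 m by rewrite mulr_gt0 ?mean_deg_gt0.
have zP : 0 < z <= 1 by rewrite mean_deg_gt0 mean_deg_le1.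
have xP : 0 < x <= s by rewrite x0.
have s_ef : 4 * rho%:R * s <= rel_err m by lra.
have mu_ef : 68 * mu * rho%:R * s <= rel_err m by lra.
have cP : 2 * (rho%:R ^+ 2 * s / mean_deg i0 m) <= rel_err m * rho%:R.
  rewrite mulrA ler_pdivrMr ?mean_deg_gt0 //.
  have h1 : rho%:R * (2 * rho%:R * s) <= rho%:R * (mean_deg i0 m * eps0).
    by rewrite ler_wpM2l ?ler0n.
  have h2 : rho%:R * (mean_deg i0 m * eps0) <= rho%:R * (mean_deg i0 m * rel_err m).
    by rewrite ler_wpM2l ?ler0n // ler_wpM2l // ltW // mean_deg_gt0.
  rewrite expr2; lra.
have up := drift_upper k1P w0 zP ef0 xP rho1 mu0 s_ef mu_ef erefl z'P h'P S_L S_f S_t S_t'.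
have lo := drift_lower k1P w0 zP ef0 xP rho1 mu0 s_ef mu_ef erefl z'P h'P S_L S_f S_t.
have {}up := up cP.
have potE A : A \in S -> pot_at i (U :\: inc A) T =
   expR (mu * (norm_deg i U T - z - h)) *
     expR (mu * (z - z' - (h' - h) - (hit inc (F i) U T A)%:R / D i))
   + expR (mu * (z - h - norm_deg i U T)) *
     expR (mu * ((hit inc (F i) U T A)%:R / D i - (z - z' + (h' - h)))).
  move=> AS; rewrite /pot_at (cardU A) // -/z' -/h'.
  have -> : norm_deg i (U :\: inc A) T = norm_deg i U T - (hit inc (F i) U T A)%:R / D i.
    by rewrite /norm_deg -(deg_setD inc (F i) U T A) natrD mulrDl addrK.
  by rewrite -!expRD; congr (expR _ + expR _); ring.
rewrite (eq_bigl (mem S)); last by move=> A; rewrite !inE.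
rewrite (eq_bigr _ potE) big_split /= -!mulr_sumr.
have SG : #|S|%:R <= #|G|%:R :> R.
  rewrite ler_nat; apply: subset_leq_card; apply/fintype.subsetP => A.
  by rewrite inE => /andP[].
rewrite /pot_at -/m -/z -/h [leRHS]mulrDr.
by apply: lerD; rewrite [leRHS]mulrC ler_wpM2l ?expR_ge0 //; apply: le_trans SG.
Qed.

(** Averaging over [G]: points of [A] drop out of the potential, and [pot_at_step] handles the
    others, so the mean new potential is at most the old one. [G] is nonempty because degrees in [U]
    are positive. *)
Lemma potential_step : exists2 A, A \in G & potential (U :\: inc A) <= 1.
Proof.
have [U0 Um] := andP Um0.
have G0 : (0 < #|G|)%N.
  have /card_gt0P[T TU] := U0.
  have := potential_bound i0 mu_gt0 PhiU TU => /andP[lo _].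
  have : 0 < norm_deg i0 U T.
    apply: lt_le_trans lo; rewrite mulr_gt0 ?mean_deg_gt0 //.
    by have := ef1; lra.
  rewrite /norm_deg pmulr_lgt0 ?invr_gt0 // ltr0n => /leq_trans; apply.
  by apply: subset_leq_card; apply/fintype.subsetP => A; rewrite inE => /andP[].
apply: contrapT => noA.
have all1 A : A \in G -> 1 < potential (U :\: inc A).
  by move=> AG; rewrite ltNge; apply/negP => le1; apply: noA; exists A.
have : \sum_(A in G) (1 : R) < \sum_(A in G) potential (U :\: inc A).
  apply: ltr_sum => //; apply/hasP.
  by have /card_gt0P[A AG] := G0; exists A; rewrite ?mem_index_enum.
rewrite sumr_const; apply/negP; rewrite -leNgt.
apply: (@le_trans _ _ (#|G|%:R * potential U)); last first.
  by rewrite -[leRHS]mulr1 ler_wpM2l ?ler0n.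
rewrite /potential exchange_big mulr_sumr /=; apply: ler_sum => i _.
rewrite mulr_sumr.
rewrite [leLHS](_ : _ = \sum_(T in U) \sum_(A in G | T \notin inc A) pot_at i (U :\: inc A) T).
  by apply: ler_sum => T TU; exact: pot_at_step.
rewrite (exchange_big_dep (mem U)) //=; last first.
  by move=> A T _; rewrite inE => /andP[].
apply: eq_bigr => T TU; apply: eq_bigl => A.
by rewrite [T \in _ :\: _]inE TU andbT.
Qed.
End Step.

Section Loop.
Variables (U0 : {set V}) (u : R).
Hypothesis cardU0 : #|U0| = m0.
Hypothesis m0_gt0 : (0 < m0)%N.
Hypothesis u01 : 0 < u <= 1.
Hypothesis us : (rk i0)%:R / (u * m0%:R) <= s.
Hypothesis eps0_u : eps0 * u ^- (11 * rho) <= 1 / 10.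
Hypothesis s_u : 2 * rho%:R * s <= u ^+ rho * eps0.

(** The inequality on [#|C|] records that the chosen blocks do not overlap; the last one, that a
    final step overshoots the target by at most one block. *)
Let invariant (U : {set V}) (C : {set B}) : Prop :=
  [/\ U \subset U0, C \subset F i0, U0 :\: U \subset \bigcup_(A in C) inc A,
      (#|C| * rk i0 + #|U| <= m0)%N & u * m0%:R <= #|U|%:R + (rk i0)%:R] /\
  potential U <= 1.

Let invariant_step U C : invariant U C -> u * m0%:R < #|U|%:R ->
  exists A, (0 < rk i0 <= #|U|)%N /\
    invariant (U :\: inc A) (A |: C) /\ #|U :\: inc A| = (#|U| - rk i0)%N.
Proof.
move=> [[UU0 CF cov cC uU] Phi] um.
have /andP[u0 u1] := u01; have m00 : 0 < m0%:R :> R by rewrite ltr0n.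
have um0 : 0 < u * m0%:R by rewrite mulr_gt0.
have U_gt0 : (0 < #|U|)%N by rewrite -(ltr0n R); exact: lt_trans um.
have U_le : (#|U| <= m0)%N by rewrite -cardU0; exact: subset_leq_card.
have Um0 : (0 < #|U| <= m0)%N by rewrite U_gt0.
have ratio : u <= #|U|%:R / m0%:R by rewrite ler_pdivlMr // ltW.
have xs : (rk i0)%:R / #|U|%:R <= s.
  apply: le_trans us; rewrite ler_wpM2l ?ler0n // lef_pV2 ?posrE ?ltr0n //.
  exact: ltW.
have ef1 : rel_err #|U| <= 1 / 10.
  apply: le_trans eps0_u; rewrite /rel_err ler_pM2l // -exprVn.
  rewrite lerXn2r ?nnegrE ?invr_ge0 ?divr_ge0 ?ler0n ?(ltW u0) //.
  by rewrite -invf_div lef_pV2 ?posrE // divr_gt0 ?ltr0n.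
have s_z : 2 * rho%:R * s <= mean_deg i0 #|U| * eps0.
  apply: le_trans s_u _; rewrite ler_pM2r //.
  apply: (@le_trans _ _ (u ^+ (rk i0).-1)).
    rewrite ler_wiXn2l ?(ltW u0) //.
    by apply: leq_trans (leq_pred _) _; case/andP: (rkP i0).
  by rewrite lerXn2r ?nnegrE ?divr_ge0 ?ler0n ?(ltW u0).
have [A] := potential_step Um0 xs ef1 s_z Phi.
rewrite inE => /andP[AF AU] Phi'; exists A.
have cA : #|inc A| = rk i0 := Frk AF.
have qU : (rk i0 <= #|U|)%N by rewrite -cA subset_leq_card.
have q0 : (0 < rk i0)%N by case/andP: (rkP i0).
have cUA : #|U :\: inc A| = (#|U| - rk i0)%N by rewrite cardsDS // cA.
rewrite qU q0; split=> //; split=> //; split=> //; split.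
- by apply: fintype.subset_trans UU0; exact: finset.subsetDl.
- by rewrite finset.subUset finset.sub1set AF.
- rewrite finset.setDDr finset.bigcup_setU big_set1 finset.setUC finset.setUSS //.
  exact: finset.subsetIr.
- by rewrite cUA cardsU1; exact: greedy_count cC qU.
- by rewrite cUA natrB // subrK ltW.
Qed.

(** Initial deviations are at most half the tolerance, so each of the [2 * #|I| * m0] exponentials
    is at most exp(- mu eps0 / 2) and the potential starts at most 1. Then [potential_step] is
    iterated until a fraction [u] remains. *)
Lemma greedy_cover : (2 * #|I| * m0)%:R <= expR (mu * (eps0 / 2)) ->
  (forall i T, T \in U0 -> `|norm_deg i U0 T - 1| <= eps0 / 2) ->
  exists (U : {set V}) (C : {set B}),
  [/\ U \subset U0, C \subset F i0, U0 :\: U \subset \bigcup_(A in C) inc A,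
      (#|C| * rk i0 <= m0)%N & #|U|%:R <= u * m0%:R <= #|U|%:R + (rk i0)%:R] /\
  forall i T, T \in U ->
    mean_deg i #|U| * (1 - rel_err #|U|) <= norm_deg i U T
    <= mean_deg i #|U| * (1 + rel_err #|U|).
Proof.
move=> mu_large reg0; have /andP[u0 u1] := u01.
have mm : m0%:R / m0%:R = 1 :> R by rewrite divff // pnatr_eq0 -lt0n.
have init : invariant U0 finset.set0.
  split; first split=> //.
  - exact: finset.sub0set.
  - by rewrite finset.setDv finset.sub0set.
  - by rewrite cards0 cardU0.
  - rewrite cardU0; apply: le_trans (_ : m0%:R <= _); last by rewrite lerDl ler0n.
    by rewrite ler_piMl ?ler0n.
  have z1 i : mean_deg i #|U0| = 1 by rewrite /mean_deg cardU0 mm expr1n.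
  have e1 : rel_err #|U0| = eps0 by rewrite /rel_err cardU0 mm expr1n mulr1.
  apply: (@le_trans _ _ (\sum_(i : I) \sum_(T in U0) 2 * (expR (mu * (eps0 / 2)))^-1)).
    apply: ler_sum => i _; apply: ler_sum => T TU.
    have := reg0 i T TU; rewrite ler_norml => /andP[lo hi].
    rewrite /pot_at z1 e1 mul1r -expRN -[- (mu * _)]mulrN mulr_natl mulr2n.
    by apply: lerD; rewrite ler_expR ler_pM2l //; lra.
  rewrite !sumr_const cardU0 -!mulrnA -[_ *+ (_ * _)]mulr_natr mulrAC.
  rewrite ler_pdivrMr ?expR_gt0 // mul1r -natrM.
  apply: le_trans mu_large; rewrite ler_nat [(m0 * _)%N]mulnC mulnA.
  by rewrite leq_mul2r leq_mul2l; apply/orP; right; apply/eq_leq/eq_card.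
have loop n : forall (U : {set V}) (C : {set B}), (#|U| <= n)%N -> invariant U C ->
    exists U' C', invariant U' C' /\ #|U'|%:R <= u * m0%:R.
  elim: n => [|n IH] U C Un inv.
    exists U, C; split=> //; move: Un; rewrite leqn0 => /eqP ->.
    by rewrite mulr_ge0 ?ler0n ?ltW.
  have [le|lt] := leP #|U|%:R (u * m0%:R); first by exists U, C.
  have [A [/andP[q0 qU] [inv' cU]]] := invariant_step inv lt.
  by apply: IH inv'; rewrite cU; exact: sub_fuel Un q0.
have [U [C [[[UU0 CF cov cC uU] Phi] Ule]]] := loop _ _ _ (leqnn _) init.
exists U, C; split.
  split=> //; first by apply: leq_trans cC; rewrite leq_addr.
  by rewrite Ule.
by move=> i T; exact: potential_bound.
Qed.
End Loop.
End RandomGreedy.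

(** * Coverings of k-subsets by 2k-subsets *)

Lemma exists_superset (X : finType) (S : {set X}) m : (#|S| <= m <= #|X|)%N ->
  exists2 A : {set X}, S \subset A & #|A| = m.
Proof.
move=> /andP[Sm mX].
have : (0 < #|[set A in uniform_sets X m | S \subset A]|)%N.
  by rewrite card_supersets // bin_gt0 leq_sub2r.
by move=> /card_gt0P[A]; rewrite !inE => /andP[/eqP cA SA]; exists A.
Qed.

Lemma bin_codeg_le (R : realType) n k b : (0 < k)%N -> (k < b <= 2 * k)%N -> (2 * k <= n)%N ->
  'C(n - k.+1, b - k.+1)%:R <= (2 * k%:R / n%:R) * 'C(n - k, b - k)%:R :> R.
Proof.
move=> k0 /andP[kb b2k] kn.
have n0 : (0 < n)%N by lia.
have := mul_bin_diag (n - k) (b - k.+1).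
have -> : (n - k).-1 = (n - k.+1)%N by lia.
have -> : (b - k.+1).+1 = (b - k)%N by lia.
move=> e.
rewrite mulrAC ler_pdivlMr ?ltr0n // -!natrM ler_nat.
set P := 'C(_, _) in e *; set Q := 'C(_, _) in e *.
have h1 : (n * P <= 2 * ((n - k) * P))%N by rewrite mulnA leq_mul2r; apply/orP; right; lia.
have h2 : (2 * ((b - k) * Q) <= 2 * k * Q)%N by rewrite mulnA leq_mul2r; apply/orP; right; lia.
by apply: leq_trans h2; rewrite -e mulnC.
Qed.

Lemma leq_bin_self n k : (0 < k < n)%N -> (n <= 'C(n, k))%N.
Proof.
elim: n k => [|n IH] [|k] //= kn.
have [->|ne] := eqVneq k.+1 n; first by rewrite binSn.
have h1 := IH k.+1 ltac:(lia); have : (0 < 'C(n, k))%N by rewrite bin_gt0; lia.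
by rewrite binS; lia.
Qed.

Lemma expR1_le4 (R : realType) : expR 1 <= 4 :> R.
Proof.
have h : expR (1 / 2) <= 2 :> R.
  by apply: le_trans (expR_le_quad (lexx _)) _; rewrite expr2; lra.
have -> : expR 1 = expR (1 / 2) * expR (1 / 2) :> R.
  by rewrite -expRD; congr expR; field.
have -> : 4 = 2 * 2 :> R by ring.
by apply: ler_pM; rewrite ?expR_ge0.
Qed.

(** The three summands count the 2k-sets of the first phase, the b-sets of the second, and the
    k-sets left over. The tolerances are at least of order Q^11 and enter squared, and the second
    phase divides the codegree ratio by [Q]; Q^24 leaves room for this. *)
Lemma covering_bound (R : realType) n k b (u0 u1 : R)
    (r := 'C(2 * k, k)) (r' := 'C(b, k)) (v := 'C(n, k))
    (Q := u1 ^+ r' * (u0 / 2) ^+ r) (s := 2 * k%:R * r%:R / (u0 * n%:R)) :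
  (0 < k)%N -> (k < b <= 2 * k)%N -> (2 * k <= n)%N ->
  0 < u0 <= 1 -> 0 < u1 <= 1 ->
  400 * (400 * (ln (4 * v%:R) * (r%:R * s))) <= Q ^+ 24 ->
  exists C : {set {set 'I_n}},
  [/\ forall A, A \in C -> #|A| = (2 * k)%N,
      forall T : {set 'I_n}, #|T| = k -> exists2 A, A \in C & T \subset A &
      #|C|%:R <= v%:R / r%:R + u0 * v%:R / r'%:R + u0 * u1 * v%:R].
Proof.
move=> k0 kb kn u0P u1P; have [u0_0 u0_1] := andP u0P; have [u1_0 u1_1] := andP u1P.
have [k_b b_2k] := andP kb.
have kbi (i : bool) : (k < (if i then 2 * k else b) <= 2 * k)%N.
  by case: i; rewrite ?kb ?leqnn ?andbT // mul2n -addnn -[ltnLHS]addn0 ltn_add2l.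
set lnv := ln _ => HQ.
have n0 : (0 < n)%N by lia.
have nR : 0 < n%:R :> R by rewrite ltr0n.
have kR : 0 < k%:R :> R by rewrite ltr0n.
have v0 : (0 < v)%N by rewrite bin_gt0 (leq_trans _ kn) // leq_pmull.
have vR : 0 < v%:R :> R by rewrite ltr0n.
have vn : (n <= v)%N.
  by apply: leq_bin_self; move: k0 kn; clear; lia.
have r'0 : (0 < r')%N by rewrite bin_gt0 ltnW.
have r'r : (r' <= r)%N by rewrite /r /r' leq_bin2l.
have r0 : (0 < r)%N := leq_trans r'0 r'r.
have rR : 1 <= r%:R :> R by rewrite ler1n.
have r'R : 1 <= r'%:R :> R by rewrite ler1n.
have r'rR : r'%:R <= r%:R :> R by rewrite ler_nat.
have ln1 : 1 <= lnv.
  rewrite -[leLHS]expRK ler_ln ?posrE ?expR_gt0 ?mulr_gt0 //.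
  by apply: le_trans (expR1_le4 R) _; rewrite ler_peMr // ler1n.
have s0 : 0 < s by rewrite divr_gt0 // !mulr_gt0 // ltr0n.
have a_0 : 0 < u0 / 2 by rewrite divr_gt0.
have a_1 : u0 / 2 <= 1 by move: u0_1; clear; lra.
have p1 : 0 < u1 ^+ r' <= 1 by rewrite exprn_gt0 //= exprn_ile1 // ltW.
have p2 : 0 < (u0 / 2) ^+ r <= 1 by rewrite exprn_gt0 //= exprn_ile1 // ltW.
have [p1_0 p1_1] := andP p1; have [p2_0 p2_1] := andP p2.
have Q0 : 0 < Q by rewrite mulr_gt0.
have Q1 : Q <= 1 by rewrite mulr_ile1 // ltW.
have Qp1 : Q <= u1 ^+ r' by rewrite ler_piMr // ltW.
have Qp2 : Q <= (u0 / 2) ^+ r by rewrite ler_piMl // ltW.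
have Qpow i j : (i <= j)%N -> Q ^+ j <= Q ^+ i by move=> ij; rewrite ler_wiXn2l // ltW.
have Qpos j : 0 < Q ^+ j by rewrite exprn_gt0.
have HQj j : (j <= 24)%N -> 400 * (400 * (lnv * (r%:R * s))) <= Q ^+ j.
  by move=> /Qpow; apply: le_trans.
have rs0 : 0 < r%:R * s by rewrite mulr_gt0 ?ltr0n.
have HQ1 j : (j <= 24)%N -> 400 * (400 * (r%:R * s)) <= Q ^+ j.
  move=> /HQj; apply: le_trans; do 2!(apply: ler_wpM2l; first exact: ler0n).
  by rewrite ler_peMl // ltW.
have lnv0 : 0 < lnv by exact: lt_le_trans ln1.
have lrs0 : 0 < lnv * (r%:R * s) by rewrite mulr_gt0.
have s_le : s <= 1 / 1000.
  have : s <= r%:R * s by rewrite ler_peMl // ltW.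
  by move: (HQ1 0 isT) s0; rewrite expr0; clear; lra.

pose V0 : {set {set 'I_n}} := ksubsets k [set: 'I_n].
have cV0 : #|V0| = v by rewrite card_ksubsets cardsT card_ord.
(* [true] indexes the 2k-sets, from which blocks are taken first; [false] the b-sets, tracked for
   the second phase. *)
pose F (i : bool) := uniform_sets 'I_n (if i then 2 * k else b)%N.
pose rk (i : bool) := if i then r else r'.
pose D (i : bool) : R := 'C(n - k, (if i then 2 * k else b) - k)%:R.
have Frk i A : A \in F i -> #|ksubsets k A| = rk i.
  by rewrite inE card_ksubsets => /eqP ->; rewrite /rk; case: i.
have rkP i : (0 < rk i <= r)%N by case: i; rewrite /= ?r0 ?r'0 ?leqnn.
have D0 i : 0 < D i.
  rewrite ltr0n bin_gt0 leq_sub2r //; apply: leq_trans kn.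
  by case/andP: (kbi i).
have codegP i T1 T2 : T1 != T2 -> (codeg (ksubsets k) (F i) T1 T2)%:R <= s * D i.
  move=> neT; have /andP[kbi1 _] := kbi i.
  apply: le_trans (_ : 'C(n - k.+1, (if i then 2 * k else b) - k.+1)%:R <= _).
    by have := codeg_uniform_sets neT kbi1; rewrite card_ord ler_nat.
  apply: le_trans (bin_codeg_le R k0 (kbi i) kn) _; rewrite ler_wpM2r ?ler0n //.
  rewrite /s (_ : _ / (u0 * _) = 2 * k%:R / n%:R * (r%:R / u0)); last by field; rewrite !gt_eqF.
  rewrite ler_peMr ?divr_ge0 ?mulr_ge0 ?ler0n // ler_pdivlMr // mul1r.
  exact: le_trans rR.
(* [mu1] makes [expR (mu1 * (e1 / 2))] equal to [4 * v], the number of exponentials in the initial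
   potential. [e1] is such that its magnification by [(u0 / 2) ^- (11 * r)] is exactly [e2 / 2], the
   deviation allowed at the start of the second phase. *)
pose e1 := Q ^+ 11 / 20; pose mu1 := 2 * lnv / e1.
have e1_0 : 0 < e1 by rewrite divr_gt0.
have mu1_0 : 0 < mu1 by rewrite !mulr_gt0 ?invr_gt0.
have c1 : 4 * r%:R * s <= e1.
  by move: (HQ1 11%N isT) rs0; rewrite /e1; clear; lra.
have c2 : 68 * mu1 * r%:R * s <= e1.
  have -> : 68 * mu1 * r%:R * s = 136 * (lnv * (r%:R * s)) / e1 by rewrite /mu1; field; rewrite gt_eqF.
  rewrite ler_pdivrMr //.
  have -> : e1 * e1 = Q ^+ 22 / 400 by rewrite /e1; field.
  by move: (HQj 22 isT) lrs0; clear; lra.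
have c3 : r%:R / (u0 * v%:R) <= s.
  apply: ler_pM; rewrite ?invr_ge0 ?mulr_ge0 ?ler0n ?(ltW u0_0) //.
    by rewrite ler_peMl ?ler0n // -natrM ler1n muln_gt0.
  by rewrite lef_pV2 ?posrE ?mulr_gt0 // ler_pM2l // ler_nat.
clearbody s.
have u0r : (u0 / 2) ^+ r <= u0 ^+ r.
  by rewrite lerXn2r ?nnegrE ?(ltW u0_0) ?(ltW a_0) //; move: u0_0; clear; lra.
have c4 : e1 * u0 ^- (11 * r) <= 1 / 10.
  rewrite ler_pdivrMr ?exprn_gt0 // mulnC exprM.
  have : Q ^+ 11 <= (u0 ^+ r) ^+ 11.
    by rewrite lerXn2r ?nnegrE ?exprn_ge0 ?(ltW u0_0) ?(ltW Q0) // (le_trans Qp2).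
  by move: (Qpos 11%N); rewrite /e1; clear; lra.
have c5 : 2 * r%:R * s <= u0 ^+ r * e1.
  apply: (@le_trans _ _ (Q * e1)); last by rewrite ler_pM2r // (le_trans Qp2).
  have -> : Q * e1 = Q ^+ 12 / 20 by rewrite /e1 [in RHS]exprS mulrA.
  by move: (HQ1 12%N isT) rs0; clear; lra.
have mu1_large : (2 * #|{: bool}| * v)%:R <= expR (mu1 * (e1 / 2)).
  have -> : mu1 * (e1 / 2) = lnv by rewrite /mu1; field; rewrite gt_eqF.
  by rewrite lnK ?posrE ?mulr_gt0 // card_bool natrM.
have reg0 i T : T \in V0 -> `|norm_deg (ksubsets k) F D i V0 T - 1| <= e1 / 2.
  rewrite inE => /andP[_ /eqP cT].
  rewrite /norm_deg deg_uniform_sets ?card_ord //; last by apply: ltnW; case/andP: (kbi i).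
  by rewrite divff ?subrr ?normr0 ?(ltW (divr_gt0 _ _)) // gt_eqF // D0.
have [U1 [C1 [[U1V C1F cov1 cC1 /andP[U1u uU1]] reg1]]] :=
  @greedy_cover R _ _ (ksubsets k) _ F rk D true r v e1 mu1 s Frk rkP D0 codegP
    s0 mu1_0 e1_0 c1 c2 V0 u0 cV0 v0 u0P c3 c4 c5 mu1_large reg0.

set m1 := #|U1| in U1u uU1 reg1.
have m1v : (m1 <= v)%N by rewrite -cV0 subset_leq_card.
have u0v : 0 < u0 * v%:R by rewrite mulr_gt0.
(* The overshoot of the last step is far below u0 v / 2; this is why [Q] contains u0 / 2 and not
   u0. *)
have m1_lo : u0 / 2 * v%:R <= m1%:R.
  have : r%:R <= 1 / 1000 * (u0 * v%:R).
    by rewrite -ler_pdivrMr // (le_trans c3).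
  by move: uU1 u0v; rewrite /=; clear; lra.
have m1R : 0 < m1%:R :> R by apply: lt_le_trans m1_lo; rewrite mulr_gt0.
have m1_0 : (0 < m1)%N by rewrite -(ltr0n R).
pose z1 : R := mean_deg R rk v false m1.
have ratio : u0 / 2 <= m1%:R / v%:R by rewrite ler_pdivlMr.
have z1Q : Q <= z1.
  apply: le_trans Qp2 _; rewrite /z1 /mean_deg /=.
  apply: (@le_trans _ _ ((u0 / 2) ^+ r'.-1)).
    by rewrite ler_wiXn2l ?(ltW a_0) // ?(leq_trans (leq_pred _)).
  by rewrite lerXn2r ?nnegrE ?(ltW a_0) ?divr_ge0 ?ler0n.
have z1_0 : 0 < z1 := lt_le_trans Q0 z1Q.
(* Normalising by the degree that b-sets retain after the first phase makes the second start near 1.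
   As z1 >= Q, the codegree ratio grows by at most 1 / Q; the 2 in [s2] accounts for m1 >= u0 v /
   2. *)
pose D2 (_ : unit) : R := D false * z1.
pose s2 := 2 * s / Q.
have s2_0 : 0 < s2 by apply: divr_gt0 => //; apply: mulr_gt0.
have r's2_0 : 0 < r'%:R * s2 by rewrite mulr_gt0 // ltr0n.
have lr's2_0 : 0 < lnv * (r'%:R * s2) by rewrite mulr_gt0.
have HB j : (j <= 23)%N -> 200 * (400 * (r'%:R * s2)) <= Q ^+ j.
  move=> j23; have := HQ1 j.+1 j23; rewrite exprS [Q * _]mulrC -ler_pdivrMr //.
  apply: le_trans.
  rewrite (_ : 200 * _ = 400 * (400 * (r'%:R * s)) / Q); last by rewrite /s2; ring.
  rewrite ler_pM2r ?invr_gt0 //.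
  have : r'%:R * s <= r%:R * s by rewrite ler_pM2r.
  by clear; lra.
have HBl j : (j <= 23)%N -> 200 * (400 * (lnv * (r'%:R * s2))) <= Q ^+ j.
  move=> j23; have := HQj j.+1 j23; rewrite exprS [Q * _]mulrC -ler_pdivrMr //.
  apply: le_trans.
  rewrite (_ : 200 * _ = 400 * (400 * (lnv * (r'%:R * s))) / Q); last by rewrite /s2; ring.
  rewrite ler_pM2r ?invr_gt0 //.
  have : lnv * (r'%:R * s) <= lnv * (r%:R * s) by rewrite ler_pM2l ?ler_pM2r.
  by clear; lra.
pose e2 := u1 ^+ (11 * r') / 10; pose mu2 := 2 * lnv / e2.
have e2_0 : 0 < e2 by rewrite divr_gt0 // exprn_gt0.
have mu2_0 : 0 < mu2 by rewrite !mulr_gt0 ?invr_gt0.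
have e2Q : Q ^+ 11 / 10 <= e2.
  rewrite ler_pM2r // mulnC exprM.
  by rewrite lerXn2r ?nnegrE ?exprn_ge0 ?(ltW u1_0) ?(ltW Q0).
have d1 : 4 * r'%:R * s2 <= e2 by move: (HB 11%N isT) e2Q r's2_0; clear; lra.
have d2 : 68 * mu2 * r'%:R * s2 <= e2.
  have -> : 68 * mu2 * r'%:R * s2 = 136 * (lnv * (r'%:R * s2)) / e2.
    by rewrite /mu2; field; rewrite gt_eqF.
  rewrite ler_pdivrMr //.
  have q11 : 0 <= Q ^+ 11 / 10 by rewrite divr_ge0 // ltW.
  have := ler_pM q11 q11 e2Q e2Q.
  have -> : Q ^+ 11 / 10 * (Q ^+ 11 / 10) = Q ^+ 22 / 100 by field.
  by move: (HBl 22 isT) lr's2_0; clear; lra.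
have Qu1 : Q <= u1.
  by apply: le_trans Qp1 _; rewrite -{2}(expr1 u1) ler_wiXn2l // ltW.
have d3 : r'%:R / (u1 * m1%:R) <= s2.
  apply: (@le_trans _ _ (2 * s / u1)); last first.
    by rewrite /s2 ler_pM2l ?mulr_gt0 // lef_pV2 ?posrE.
  rewrite invfM mulrA mulrAC ler_pM2r ?invr_gt0 //.
  have h : r%:R / (u0 / 2 * v%:R) <= 2 * s.
    have -> : r%:R / (u0 / 2 * v%:R) = 2 * (r%:R / (u0 * v%:R)) by field; rewrite !gt_eqF.
    by rewrite ler_pM2l.
  apply: le_trans h; apply: ler_pM; rewrite ?invr_ge0 ?ler0n //.
  by rewrite lef_pV2 ?posrE // mulr_gt0.
have d4 : e2 * u1 ^- (11 * r') <= 1 / 10.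
  by rewrite /e2 mulrAC divff ?gt_eqF ?exprn_gt0.
have d5 : 2 * r'%:R * s2 <= u1 ^+ r' * e2.
  have : Q * e2 <= u1 ^+ r' * e2 by rewrite ler_pM2r.
  have : Q * (Q ^+ 11 / 10) <= Q * e2 by rewrite ler_pM2l.
  rewrite mulrA -exprS.
  by move: (HB 12%N isT) r's2_0; clear; lra.
have mu2_large : (2 * #|{: unit}| * m1)%:R <= expR (mu2 * (e2 / 2)).
  have -> : mu2 * (e2 / 2) = lnv by rewrite /mu2; field; rewrite gt_eqF.
  rewrite lnK ?posrE ?mulr_gt0 // card_unit -natrM ler_nat.
  by apply: leq_mul.
have ef_e2 : rel_err r v e1 m1 <= e2 / 2.
  have -> : e2 / 2 = e1 * (u0 / 2) ^- (11 * r).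
    rewrite /e1 /e2 /Q exprMn -!exprM ![(11 * _)%N]mulnC.
    by field; rewrite gt_eqF // exprn_gt0.
  rewrite /rel_err ler_pM2l // -exprVn lerXn2r ?nnegrE ?invr_ge0 ?divr_ge0 ?ler0n ?(ltW u0_0) //.
  by rewrite -invf_div lef_pV2 ?posrE ?divr_gt0.
have regB (i : unit) T : T \in U1 ->
    `|norm_deg (ksubsets k) (fun _ => uniform_sets 'I_n b) D2 i U1 T - 1| <= e2 / 2.
  move=> TU1; have /andP[] := reg1 false T TU1.
  rewrite -/z1 => lo hi.
  have -> : norm_deg (ksubsets k) (fun _ => uniform_sets 'I_n b) D2 i U1 T =
      norm_deg (ksubsets k) F D false U1 T / z1.
    by rewrite /norm_deg /D2 invfM mulrA.
  rewrite ler_norml lerBrDr lerBlDr.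
  rewrite ler_pdivlMr // ler_pdivrMr //.
  apply/andP; split; [apply: le_trans lo|apply: le_trans hi _].
    by rewrite mulrC ler_pM2l //; move: ef_e2; clear; lra.
  by rewrite [leRHS]mulrC ler_pM2l //; move: ef_e2; clear; lra.
have Frk2 (i : unit) A : A \in uniform_sets 'I_n b -> #|ksubsets k A| = r'.
  exact: (Frk false).
have rkP2 (i : unit) : (0 < r' <= r')%N by rewrite r'0 leqnn.
have D2_0 i : 0 < D2 i by rewrite mulr_gt0.
have codegP2 (i : unit) T1 T2 : T1 != T2 ->
    (codeg (ksubsets k) (uniform_sets 'I_n b) T1 T2)%:R <= s2 * D2 i.
  move=> neT; apply: le_trans (codegP false T1 T2 neT) _.
  rewrite /D2 mulrCA [leLHS]mulrC ler_pM2l // /s2 mulrAC ler_pdivlMr //.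
  by apply: ler_pM; rewrite ?(ltW s0) ?(ltW Q0) //; move: s0; clear; lra.
have [U2 [C2 [[U2U1 C2F cov2 cC2 /andP[U2u _]] _]]] :=
  @greedy_cover R _ _ (ksubsets k) _ (fun _ => uniform_sets 'I_n b) (fun _ => r') D2 tt
   r' m1 e2 mu2 s2 Frk2 rkP2 D2_0 codegP2 s2_0 mu2_0 e2_0 d1 d2 U1 u1 erefl m1_0
   u1P d3 d4 d5 mu2_large regB.
(* The b-sets and the leftover k-sets are enlarged to 2k-sets; since 2k <= n, the default is not
   reached for sets of at most 2k elements. *)
pose ext (S : {set 'I_n}) : {set 'I_n} := 
  odflt [set: 'I_n] [pick A : {set 'I_n} | (S \subset A) && (#|A| == (2 * k)%N)].
have extP (S : {set 'I_n}) : (#|S| <= 2 * k)%N -> S \subset ext S /\ #|ext S| = (2 * k)%N.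
  move=> Sk; rewrite /ext; case: pickP => [A /andP[SA /eqP cA] //|].
  have [|A SA cA] := @exists_superset _ S (2 * k); first by rewrite Sk card_ord.
  by move=> /(_ A); rewrite SA cA eqxx.
have C2k A : A \in C2 -> (#|A| <= 2 * k)%N.
  by move=> /(fintype.subsetP C2F); rewrite inE => /eqP ->.
have U2k T : T \in U2 -> #|T| = k.
  move=> /(fintype.subsetP U2U1) /(fintype.subsetP U1V).
  by rewrite inE => /andP[_ /eqP].
exists (C1 :|: (ext @: C2 :|: ext @: U2)); split.
- move=> A; rewrite !finset.inE => /orP[/(fintype.subsetP C1F)|/orP[]].
  + by rewrite inE => /eqP.
  + by move=> /imsetP[A' /C2k /extP[_ cA'] ->].
  + move=> /imsetP[T /U2k cT ->]; apply: (proj2 (extP _ _)).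
    by rewrite cT leq_pmull.
- move=> T cT; have TV : T \in V0 by rewrite inE finset.subsetT cT eqxx.
  have [TU1|TU1] := boolP (T \in U1); last first.
    have /(fintype.subsetP cov1)/bigcupP[A AC1] : T \in V0 :\: U1 by rewrite inE TU1.
    rewrite inE => /andP[TA _]; exists A => //.
    by rewrite !finset.inE AC1.
  have [TU2|TU2] := boolP (T \in U2).
    exists (ext T); first by rewrite !finset.inE (imset_f ext TU2) !orbT.
    by apply: (proj1 (extP _ _)); rewrite cT leq_pmull.
  have /(fintype.subsetP cov2)/bigcupP[A AC2] : T \in U1 :\: U2 by rewrite inE TU2.
  rewrite inE => /andP[TA _]; exists (ext A).
    by rewrite !finset.inE (imset_f ext AC2) orbT.
  by apply: fintype.subset_trans TA _; apply: (proj1 (extP _ (C2k _ AC2))).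
apply: (@le_trans _ _ (#|C1|%:R + (#|C2|%:R + #|U2|%:R))).
  rewrite -!natrD ler_nat.
  apply: leq_trans (leq_card_setU _ _).1 _; rewrite leq_add2l.
  apply: leq_trans (leq_card_setU _ _).1 _.
  by apply: leq_add; exact: leq_imset_card.
rewrite -addrA; apply: lerD.
  by rewrite ler_pdivlMr ?ltr0n // -natrM ler_nat.
apply: lerD.
  rewrite ler_pdivlMr ?ltr0n //; apply: le_trans U1u.
  by rewrite -natrM ler_nat.
by apply: le_trans U2u _; rewrite [u0 * u1]mulrC -mulrA ler_pM2l.
Qed.

(** * Choice of the parameters *)

Lemma ln_le_sqrt (R : realType) (x : R) : 0 < x -> ln x <= 2 * Num.sqrt x.
Proof.
move=> x0; have s0 : 0 < Num.sqrt x by rewrite sqrtr_gt0.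
rewrite -{1}(sqr_sqrtr (ltW x0)) lnXn // mulr_natl ler_pMn2r //.
have h : -1 < Num.sqrt x - 1 by lra.
by have := le_ln1Dx h; rewrite [1 + _]addrC subrK; lra.
Qed.

(** This crude bound spends sqrt(n) on the logarithm; the codegree ratio has n in its denominator,
    so a factor sqrt(n) survives. *)
Lemma ln_4bin_le (R : realType) n k : (0 < k)%N -> (4 <= n)%N -> (k <= n)%N ->
  ln (4 * 'C(n, k)%:R) <= 4 * k%:R * Num.sqrt n%:R :> R.
Proof.
move=> k0 n4 kn; have n0 : (0 < n)%N := leq_trans (isT : (0 < 4)%N) n4.
have b : (4 * 'C(n, k) <= n ^ (2 * k))%N.
  rewrite mul2n -addnn expnD; apply: leq_mul.
    by apply: leq_trans n4 _; rewrite -{1}(expn1 n) leq_pexp2l.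
  apply: (@leq_trans (n ^_ k)); first by rewrite -bin_ffact leq_pmulr // fact_gt0.
  rewrite ffact_prod -[X in (_ <= n ^ X)%N]card_ord -prod_nat_const.
  by apply: leq_prod => i _; exact: leq_subr.
apply: (@le_trans _ _ (ln (n%:R ^+ (2 * k)))).
  rewrite ler_ln ?posrE ?mulr_gt0 ?ltr0n ?bin_gt0 ?exprn_gt0 ?ltr0n //.
  by rewrite -natrM -natrX ler_nat.
rewrite lnXn ?ltr0n // -[ln _ *+ _]mulr_natl natrM.
have -> : 4 * k%:R * Num.sqrt n%:R = 2 * k%:R * (2 * Num.sqrt n%:R) :> R by ring.
by rewrite ler_wpM2l ?mulr_ge0 ?ler0n // ln_le_sqrt // ltr0n.
Qed.

(** Each of the two excess terms of [covering_bound] is at most (v / r) / P, by r <= k^2 r' and u1 =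
    1 / r, and P >= 2 / eta. *)
Lemma covering_density (R : realType) (eta : R) : 0 < eta ->
  exists N, forall n k, (N <= n)%N -> (0 < k)%N -> (2 ^ (4 ^ k.+1) <= n)%N ->
  exists C : {set {set 'I_n}},
  [/\ forall A, A \in C -> #|A| = (2 * k)%N,
      forall T : {set 'I_n}, #|T| = k -> exists2 A, A \in C & T \subset A &
      #|C|%:R <= 'C(n, k)%:R / 'C(2 * k, k)%:R * (1 + eta)].
Proof.
move=> eta0.
have [P P0 Peta] : exists2 P, (0 < P)%N & 2 <= P%:R * eta.
  exists (Num.bound (2 / eta)).+1 => //.
  rewrite -ler_pdivrMr //; apply: ltW; apply: lt_le_trans (archi_boundP _) _.
    by rewrite divr_ge0 // ltW.
  by rewrite ler_nat.
have [N large] := exp_central_bin_eventually P.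
exists N => n k Nn k0 kn.
have := large n k Nn k0 kn.
have [] := block_size_bounds P0 k0.
set b := (2 * k - _)%N; set r := 'C(2 * k, k); set r' := 'C(b, k).
set w := ((32 * P * k ^ 2) ^ r)%N => kb rr' rw w9 wn.
have kkn : (4 * k <= n)%N.
  apply: leq_trans kn; apply: ltnW; apply: leq_ltn_trans (ltn_expl _ _) => //.
  by rewrite expnS leq_mul2l /= ltnW // ltn_expl.
have n4 : (4 <= n)%N by apply: leq_trans kkn; rewrite leq_pmulr.
have k2n : (2 * k <= n)%N by apply: leq_trans kkn; rewrite leq_mul2r orbT.
have k1n : (k <= n)%N by apply: leq_trans k2n; rewrite leq_pmull.
have n0 : 0 < n%:R :> R by rewrite ltr0n (leq_trans _ n4).
have kR : 0 < k%:R :> R by rewrite ltr0n.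
have PR : 0 < P%:R :> R by rewrite ltr0n.
have r0 : (0 < r)%N by rewrite bin_gt0 leq_pmull.
have r'0 : (0 < r')%N by rewrite bin_gt0; case/andP: kb => /ltnW.
have rR : 0 < r%:R :> R by rewrite ltr0n.
have r'R : 0 < r'%:R :> R by rewrite ltr0n.
have w0 : (0 < w)%N by rewrite /w expn_gt0 !muln_gt0 P0 k0.
have wR : 0 < w%:R :> R by rewrite ltr0n.
(* The small constant delta is 1 / P here. *)
pose u0 : R := (P%:R * k%:R ^+ 2)^-1; pose u1 : R := r%:R^-1.
have k2R : 1 <= k%:R ^+ 2 :> R by rewrite exprn_ege1 // ler1n.
have Pk1 : 1 <= P%:R * k%:R ^+ 2 :> R by rewrite -natrX -natrM ler1n muln_gt0 P0 expn_gt0 k0.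
have u0P : 0 < u0 <= 1.
  by rewrite invr_gt0 (lt_le_trans ltr01 Pk1) invf_le1 // (lt_le_trans ltr01 Pk1).
have u1P : 0 < u1 <= 1 by rewrite invr_gt0 rR invf_le1 // ler1n.
pose Q := u1 ^+ r' * (u0 / 2) ^+ r.
have Qw : w%:R^-1 <= Q.
  have -> : Q = ((r ^ r' * (2 * P * k ^ 2) ^ r)%N%:R)^-1.
    rewrite natrM !natrX invfM -!exprVn !natrM; congr (_ * _); congr (_ ^+ _).
    by rewrite -invfM; congr (_^-1); ring.
  rewrite lef_pV2 ?posrE ?ler_nat // ltr0n muln_gt0 !expn_gt0 r0.
  by rewrite !muln_gt0 P0 k0.
pose s : R := 2 * k%:R * r%:R / (u0 * n%:R).
have cond : 400 * (400 * (ln (4 * 'C(n, k)%:R) * (r%:R * s))) <= Q ^+ 24.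
  apply: (@le_trans _ _ ((w%:R ^+ 24)^-1)); last first.
    by rewrite -exprVn lerXn2r ?nnegrE ?invr_ge0 ?ler0n // (le_trans _ Qw) ?invr_ge0.
  have s0 : 0 <= r%:R * s.
    by rewrite !mulr_ge0 ?invr_ge0 ?mulr_ge0 ?ler0n //; case/andP: u0P => /ltW.
  have h1 : ln (4 * 'C(n, k)%:R) * (r%:R * s) <= 4 * k%:R * Num.sqrt n%:R * (r%:R * s).
    by rewrite ler_wpM2r // ln_4bin_le.
  apply: (@le_trans _ _ (400 * (400 * (4 * k%:R * Num.sqrt n%:R * (r%:R * s))))).
    by do 2!(apply: ler_wpM2l; first exact: ler0n).
  have sn0 : 0 < Num.sqrt n%:R :> R by rewrite sqrtr_gt0.
  have nE : n%:R = Num.sqrt n%:R * Num.sqrt n%:R :> R by rewrite -expr2 sqr_sqrtr ?ler0n.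
  have -> : 400 * (400 * (4 * k%:R * Num.sqrt n%:R * (r%:R * s))) =
     (400 * (400 * (8 * (P * k ^ 4 * r ^ 2))))%N%:R / Num.sqrt n%:R.
    rewrite /s /u0 !natrM {2}nE.
    by field; rewrite !gt_eqF.
  (* 33 = 9 + 24 pays for the numerical factor and for Q^-24; the surviving sqrt(n) doubles it to
     the exponent 66. *)
  have w33 : w%:R ^+ 33 <= Num.sqrt n%:R :> R.
    rewrite -(ler_pXn2r (_ : (0 < 2)%N)) ?nnegrE ?exprn_ge0 ?ler0n ?sqrtr_ge0 //.
    rewrite sqr_sqrtr ?ler0n // -exprM -natrX ler_nat /w -expnM.
    by rewrite [(r * _)%N]mulnC (_ : 33 * 2 = 66)%N.
  rewrite ler_pdivrMr // mulrC ler_pdivlMr ?exprn_gt0 //.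
  apply: le_trans w33; rewrite -[33%N]/(9 + 24)%N exprD.
  by rewrite ler_pM2r ?exprn_gt0 // -natrX ler_nat.
have [C [C2k Ccov cC]] := covering_bound k0 kb k2n u0P u1P cond.
exists C; split=> //; apply: le_trans cC _.
rewrite -/r -/r' mulrDr mulr1 -addrA lerD2l.
set v := 'C(n, k)%:R : R; have v0 : 0 <= v by rewrite ler0n.
have a1 : u0 * v / r'%:R <= v / r%:R * P%:R^-1.
  have -> : v / r%:R * P%:R^-1 = u0 * v / (r%:R / k%:R ^+ 2).
    by rewrite /u0; field; rewrite !gt_eqF.
  rewrite ler_wpM2l ?mulr_ge0 //; first by case/andP: u0P => /ltW.
  rewrite lef_pV2 ?posrE ?divr_gt0 ?exprn_gt0 // ler_pdivrMr ?exprn_gt0 //.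
  by rewrite -natrX -natrM ler_nat mulnC.
have a2 : u0 * u1 * v <= v / r%:R * P%:R^-1.
  have -> : u0 * u1 * v = v / r%:R * u0 by rewrite /u1; ring.
  rewrite ler_wpM2l ?divr_ge0 ?ler0n // lef_pV2 ?posrE ?(lt_le_trans ltr01 Pk1) //.
  by rewrite ler_peMr ?ler0n.
have a3 : v / r%:R * (2 / P%:R) <= v / r%:R * eta.
  by rewrite ler_wpM2l ?divr_ge0 ?ler0n // ler_pdivrMr // mulrC.
move: a1 a2 a3; clear; lra.
Qed.

(** * Unbiased representatives as coverings *)

Lemma k_bicoloringE n k (B : bicoloring n) :
  k_bicoloring k B = (#|[set i | B i]| == k).
Proof.
rewrite /k_bicoloring; congr (_ == _); apply: eq_card => i.
by rewrite !inE mxE; case: (B i).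
Qed.

(** A vanishing product splits the 2k elements of [A] evenly between the colours, so [A] contains k
    of the k points coloured +1. *)
Lemma unbiased_repE n k (A : {set 'I_n}) (B : bicoloring n) : (0 < k)%N ->
  #|A| = (2 * k)%N -> k_bicoloring k B -> unbiased_rep A B = ([set i | B i] \subset A).
Proof.
move=> k0 cA; rewrite k_bicoloringE => /eqP; set P := [set i | B i] => cP.
have A0 : A != finset.set0 by rewrite -card_gt0 cA muln_gt0.
have dE : dotp (incidence_vec A) (color_vec B) = #|A :&: P|%:Z - #|A :\: P|%:Z.
  rewrite /dotp; under eq_bigr => i _ do rewrite !mxE.
  transitivity (\sum_(i in A) (if i \in P then 1 else -1 : int)).
    rewrite [RHS]big_mkcond; apply: eq_bigr => i _; rewrite inE.
    by case: (i \in A); rewrite ?mul1r ?mul0r.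
  rewrite (big_setID P) /=; congr (_ + _).
    rewrite (eq_bigr (fun _ => 1)) ?sumr_const ?natz // => i.
    by rewrite finset.in_setI => /andP[_ ->].
  rewrite (eq_bigr (fun _ => -1)) ?sumr_const ?mulNrn ?natz // => i.
  by rewrite finset.in_setD => /andP[/negPf ->].
rewrite /unbiased_rep A0 dE subr_eq0 eqz_nat /=.
have cAP := cardsID P A; rewrite cA in cAP.
have APP : (#|A :&: P| <= #|P|)%N by rewrite subset_leq_card // finset.subsetIr.
rewrite (sameP finset.setIidPr eqP).
apply/eqP/idP => [e|/eqP e].
  rewrite eqEcard finset.subsetIr /= cP; move: cAP e.
  by move: #|A :&: P| #|A :\: P| => x y; clear; lia.
by move: cAP; rewrite e cP; move: #|A :\: P| => y; clear; lia.
Qed.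

(** For the set of all k-bicolorings, each member of a SUR contains C(2k, k) k-sets and every k-set
    lies in some member. *)
Lemma gamma_ge_density (R : realType) n k : (0 < k)%N -> (2 * k <= n)%N ->
  'C(n, k)%:R / 'C(2 * k, k)%:R <= (gamma n k (2 * k))%:R :> R.
Proof.
move=> k0 kn.
have k2 : (k <= 2 * k)%N by rewrite leq_pmull.
rewrite ler_pdivrMr ?ltr0n ?bin_gt0 // -natrM ler_nat.
(* [arg_minnP] requires the starting family of the minimum to be a SUR. *)
have SB (BB := k_bicolorings n k) : uniform_SUR (2 * k) BB (r_subsets n (2 * k)).
  apply/andP; split=> //; apply/forall_inP => B; rewrite inE => kB.
  have cP : #|[set i | B i]| = k by apply/eqP; rewrite -k_bicoloringE.
  have [|A PA cA] := @exists_superset _ [set i | B i] (2 * k).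
    by rewrite cP k2 card_ord.
  by apply/exists_inP; exists A; rewrite ?inE ?cA // (unbiased_repE k0 cA kB).
have : (min_SUR (2 * k) (k_bicolorings n k) <= gamma n k (2 * k))%N.
  rewrite /gamma.
  exact: (leq_bigmax_cond (F := fun BB => min_SUR (2 * k) BB)).
rewrite -(leq_pmul2r (m := 'C(2 * k, k))) ?bin_gt0 // => le_gamma; apply: leq_trans le_gamma.
rewrite /min_SUR; case: arg_minnP => // F /andP[Fr /forall_inP FB] _.
have cF A : A \in F -> #|A| = (2 * k)%N.
  by move=> /(fintype.subsetP Fr); rewrite inE => /eqP.
pose S := ksubsets k [set: 'I_n].
have cS : #|S| = 'C(n, k) by rewrite card_ksubsets cardsT card_ord.
rewrite -cS -sum1_card.
apply: (@leq_trans (\sum_(T in S) #|[set A in F | T \in ksubsets k A]|)).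
  apply: leq_sum => T; rewrite inE => /andP[_ /eqP cT].
  pose B : bicoloring n := [ffun i => i \in T].
  have BT : [set i | B i] = T by apply/finset.setP => i; rewrite inE ffunE.
  have kB : k_bicoloring k B by rewrite k_bicoloringE BT cT.
  have /FB/exists_inP[A AF] : B \in k_bicolorings n k by rewrite inE.
  rewrite (unbiased_repE k0 (cF A AF) kB) BT => TA.
  by apply/card_gt0P; exists A; rewrite !inE AF TA cT eqxx.
rewrite -sum_card_inc -sum_nat_const; apply: leq_sum => A AF.
by rewrite -(cF A AF) -card_ksubsets subset_leq_card // finset.subsetIr.
Qed.

Lemma gamma_le_covering n k (C : {set {set 'I_n}}) : (0 < k)%N ->
  (forall A, A \in C -> #|A| = (2 * k)%N) ->
  (forall T : {set 'I_n}, #|T| = k -> exists2 A, A \in C & T \subset A) ->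
  (gamma n k (2 * k) <= #|C|)%N.
Proof.
move=> k0 C2k Ccov; apply/bigmax_leqP => BB /fintype.subsetP BBk.
have CB : uniform_SUR (2 * k) BB C.
  apply/andP; split.
    by apply/fintype.subsetP => A AC; rewrite inE C2k.
  apply/forall_inP => B /BBk; rewrite inE => kB.
  have cP : #|[set i | B i]| = k by apply/eqP; rewrite -k_bicoloringE.
  have [A AC PA] := Ccov _ cP.
  by apply/exists_inP; exists A => //; rewrite (unbiased_repE k0 (C2k A AC) kB).
rewrite /min_SUR; case: arg_minnP => [|F _]; first exact: uniform_SUR_r_subsets CB.
exact.
Qed.

(** Unfolding gives 4^k ln 4 <= a ln n with a < 1/2, hence 4^(k + 1) ln 2 <= ln n. As [ln] vanishes
    on nonpositive reals, k > 0 forces the arguments of both logarithms to be positive. *)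
Lemma log4_log4_large (R : realType) (a : R) n k : 0 < a < 1 / 2 -> (0 < k)%N ->
  k%:R <= log4 (log4 ((n%:R : R) `^ a)) -> (2 ^ (4 ^ k.+1) <= n)%N.
Proof.
move=> /andP[a0 a1] k0.
have l2 : 0 < ln 2 :> R by rewrite ln_gt0 // ltr1n.
have l4E : ln 4 = 2 * ln 2 :> R.
  by rewrite (_ : 4 = 2 ^+ 2) ?lnXn ?mulr_natl // -natrX.
have l4 : 0 < ln 4 :> R by rewrite l4E mulr_gt0.
have kR : 0 < k%:R :> R by rewrite ltr0n.
rewrite {1}/log4 ler_pdivlMr // => h1.
set y := log4 _ in h1.
have lny : 0 < ln y by apply: lt_le_trans h1; rewrite mulr_gt0.
have y0 : 0 < y.
  by rewrite ltNge; apply/negP => /ln0 e; rewrite e ltxx in lny.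
have yk : 4 ^+ k <= y.
  by rewrite -ler_ln ?posrE ?exprn_gt0 // lnXn // -[_ *+ k]mulr_natl.
move: yk; rewrite /y /log4 ler_pdivlMr // ln_powR => h2.
have p4 : 0 < 4 ^+ k :> R by rewrite exprn_gt0.
have an : 0 < a * ln n%:R by apply: lt_le_trans h2; rewrite mulr_gt0.
have lnn : 0 < ln (n%:R : R) by rewrite -(pmulr_rgt0 _ a0).
have n0 : 0 < (n%:R : R).
  by rewrite ltNge; apply/negP => /ln0 e; rewrite e ltxx in lnn.
rewrite -(ler_nat R) natrX -ler_ln ?posrE ?exprn_gt0 // lnXn //.
rewrite -[_ *+ _]mulr_natl natrX exprS.
have : a * ln (n%:R : R) <= 1 / 2 * ln n%:R by rewrite ler_pM2r // ltW.
by rewrite l4E in h2; lra.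
Qed.

Local Open Scope classical_set_scope.
Local Open Scope ring_scope.

Theorem theorem3 (R : realType) (eps : R) (eps_gt0 : 0 < eps)
    (eps_lt : eps < 1 / 2) :
  exists delta : nat -> R,
    (delta n @[n --> \oo] --> (0 : R)) /\
    (exists N : nat, forall n : nat, (N <= n)%N ->
      forall k : nat, (0 < k)%N ->
        (k%:R : R) <= log4 (log4 ((n%:R : R) `^ (1 / 2 - eps))) ->
        ('C(n, k)%:R / 'C(2 * k, k)%:R : R) <= (gamma n k (2 * k))%:R /\
        ((gamma n k (2 * k))%:R : R)
          <= 'C(n, k)%:R / 'C(2 * k, k)%:R * (1 + delta n)).
Proof.
pose a : R := 1 / 2 - eps.
have aP : 0 < a < 1 / 2 by rewrite /a; apply/andP; split; lra.
pose allowed n k := (0 < k)%N && (k%:R <= log4 (log4 ((n%:R : R) `^ a))).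
pose density n k : R := 'C(n, k)%:R / 'C(2 * k, k)%:R.
(* The largest relative excess over the admissible k, so the upper bound is immediate and the
   content lies in the limit, where [N] is uniform in k. The range k <= n loses nothing, as 2k <= n
   for admissible k. *)
pose delta n : R := \big[Order.max/0]_(k < n.+1 | allowed n k)
  ((gamma n k (2 * k))%:R / density n k - 1).
have large n k : allowed n k -> (2 ^ (4 ^ k.+1) <= n)%N.
  by move=> /andP[k0]; exact: log4_log4_large.
have k2n n k : allowed n k -> (2 * k <= n)%N.
  move=> /large; apply: leq_trans; apply: ltnW.
  apply: leq_ltn_trans (ltn_expl _ _) => //.
  by rewrite expnS leq_mul // ltnW // ltn_expl.
have density_gt0 n k : allowed n k -> 0 < density n k.
  move=> nk; rewrite divr_gt0 // ltr0n bin_gt0 ?leq_pmull //.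
  by apply: leq_trans (k2n n k nk); rewrite leq_pmull.
exists delta; split.
  apply/cvgrPdist_le => e e0.
  have [N cov] := covering_density e0.
  exists N => // n /= Nn; rewrite sub0r normrN ger0_norm ?bigmax_ge_id //.
  apply: bigmax_le => [|k nk]; first exact: ltW.
  have /andP[k0 _] := nk.
  have [C [C2k Ccov cC]] := cov n k Nn k0 (large _ _ nk).
  rewrite lerBlDl ler_pdivrMr ?density_gt0 // mulrC.
  by apply: le_trans cC; rewrite ler_nat gamma_le_covering.
exists 0%N => n _ k k0 kn.
have nk : allowed n k by rewrite /allowed k0.
split; first by apply: gamma_ge_density => //; exact: k2n.
rewrite mulrC -ler_pdivrMr ?density_gt0 // -lerBlDl.
have kn1 : (k < n.+1)%N.
  by rewrite ltnS; apply: leq_trans (k2n n k nk); rewrite leq_pmull.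
rewrite /delta; pose ratio (i : 'I_n.+1) := (gamma n i (2 * i))%:R / density n i - 1.
exact: (@le_bigmax_cond _ _ _ 0 (Ordinal kn1) (fun i : 'I_n.+1 => allowed n i) ratio).
Qed.
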